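(* Let $s_0=1,s_1,s_2,\ldots$ be a sequence of real numbers such that for every $N\in\mathbb{N}$ the Hankel matrices $(s_{i+j-2})_{1\le i,j\le N}$ and $(s_{i+j-1})_{1\le i,j\le N}$ are positive definite. The Stieltjes moment problem for $(s_k)$ is indeterminate if and only if the following relations hold: $$M_\infty=\lim_{T\to\infty}\left(\left(C^T\right)^{-1}\Gamma_T,\Gamma_T\right)<+\infty,$$ $$L_\infty=\lim_{K\to\infty}\frac{\left(\left(C^{K}\right)^{-1}\left(R^{K}\right)^*\Gamma_{K},e_1\right)}{\left(\left(C^{K}\right)^{-1}\Gamma_{K},e_1\right)}<+\infty .$$
   Context: The Stieltjes moment problem asks for a Borel measure $\rho$ supported on $(0,+\infty)$ with $s_k=\int\lambda^k\,d\rho(\lambda)$ for all $k\ge0$; it is determinate if it has only one solution and indeterminate otherwise. Let $A$ be the semi-infinite Jacobi matrix with off-diagonal entries $a_1,a_2,\ldots>0$ and diagonal entries $b_1,b_2,\ldots\in\mathbb{R}$ determined by the moments (so that $s_k$ is the upper left entry of the $k$-th power of $A$ for all $k$). In the Stieltjes case it has the form $b_1=\frac{1}{m_1l_1}$, $b_i=\frac1{m_i}\left(\frac1{l_{i-1}}+\frac1{l_i}\right)$ for $i\ge2$, $a_i=\frac{1}{l_i\sqrt{m_im_{i+1}}}$ for $i\ge1$, with positive $m_i$, $l_i$ (normalized by $m_1=1$), interpreted as the masses and the lengths of intervals of a string. The mass and length of the whole string are $M_\infty=\sum_{k\ge1}m_k$ and $L_\infty=\sum_{k\ge1}l_k$.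 The polynomials $\mathcal{T}_t(\lambda)$ are defined by $\mathcal{T}_0=0$, $\mathcal{T}_1=1$, $\mathcal{T}_{t+1}+\mathcal{T}_{t-1}-\lambda\mathcal{T}_t=0$, and $\Gamma_T=(\mathcal{T}_T(0),\mathcal{T}_{T-1}(0),\ldots,\mathcal{T}_1(0))^{\top}$. Define the response vector entries $r_{t-1}$, $t\ge1$, by replacing each power $\lambda^k$ in $\mathcal{T}_t(\lambda)$ by $s_k$ (so $r_0=1$). The $T\times T$ positive definite matrix $C^T$ is $$C^T_{ij}=\sum_{k=0}^{T-\max\{i,j\}}r_{|i-j|+2k},\qquad i,j=1,\ldots,T.$$ The response operator $R^T$ acts on $f=(f_0,\ldots,f_{T-1})$ by $(R^Tf)_t=\sum_{s=0}^{t-1}r_sf_{t-1-s}$, $t=1,\ldots,T$, and $(R^T)^*$ is its adjoint. $e_1=(1,0,\ldots,0)$ and $(\cdot,\cdot)$ is the standard inner product.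
   Formalization: The printed quotient for L∞ is never positive for K≥2, so its limit cannot be L∞>0. The theorem inserts a minus sign before the quotient and takes (R^K)^* with outputs and Γ_K paired at equal times (the time-t output with T_{K-t}(0)) instead of by position. *)

(* Defs.v *)
From HB Require Import structures.
From mathcomp Require Import all_boot all_order all_algebra.
From mathcomp Require Import all_classical all_reals all_analysis.

Set Implicit Arguments.
Unset Strict Implicit.
Unset Printing Implicit Defensive.

Import Order.TTheory GRing.Theory Num.Theory.
Import numFieldNormedType.Exports.

Local Open Scope classical_set_scope.
Local Open Scope ring_scope.

(* Mathematical objects indexed from 1 are indexed from 0 here: [m i] is
   m_(i+1), [string_a m l i] is a_(i+1), the entry [C i j] is C_(i+1,j+1).
   The moments s_k and the response vector r_k keep their indices. *)

Definition inner (R : realType) (n : nat) (u v : 'cV[R]_n) : R :=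
  \sum_(i < n) u i 0 * v i 0.

Definition posdefmx (R : realType) (n : nat) (H : 'M[R]_n) : Prop :=
  H^T = H /\ forall v : 'cV[R]_n, v != 0 -> 0 < inner (H *m v) v.

Definition hankel_mx (R : realType) (s : nat -> R) (n : nat) : 'M[R]_n :=
  \matrix_(i < n, j < n) s (i + j)%N.

Definition stieltjes_solution (R : realType) (s : nat -> R)
    (rho : {measure set (measurableTypeR R) -> \bar R}) : Prop :=
  rho `]-oo, 0%R]%classic = 0%E /\
  forall k : nat,
    rho.-integrable setT (fun x : measurableTypeR R => (x ^+ k)%:E) /\
    (\int[rho]_x (x ^+ k)%:E = (s k)%:E)%E.

(* Determinacy is uniqueness.  It must not be strengthened to "exactly one
   solution": if M_oo < +oo = L_oo then the only measure on [0, +oo[ with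
   moments [s] charges {0}, and there is no solution on ]0, +oo[ at all. *)
Definition stieltjes_determinate (R : realType) (s : nat -> R) : Prop :=
  forall rho1 rho2 : {measure set (measurableTypeR R) -> \bar R},
    stieltjes_solution s rho1 -> stieltjes_solution s rho2 ->
    forall B : set (measurableTypeR R), measurable B -> rho1 B = rho2 B.

Definition stieltjes_indeterminate (R : realType) (s : nat -> R) : Prop :=
  ~ stieltjes_determinate s.

(* The action of the semi-infinite Jacobi matrix on sequences. *)
Definition jacobi (R : realType) (a b : nat -> R) (u : nat -> R) : nat -> R :=
  fun n => (if n is n'.+1 then a n' * u n' else 0) + b n * u n + a n * u n.+1.

(* The upper left entry of the k-th power of the Jacobi matrix. *)
Definition jacobi_moment (R : realType) (a b : nat -> R) (k : nat) : R :=
  iter k (jacobi a b) (fun n => (n == 0%N)%:R) 0%N.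

Definition string_a (R : realType) (m l : nat -> R) (i : nat) : R :=
  1 / (l i * Num.sqrt (m i * m i.+1)).

Definition string_b (R : realType) (m l : nat -> R) (i : nat) : R :=
  if i is i'.+1 then 1 / m i * (1 / l i' + 1 / l i) else 1 / (m 0%N * l 0%N).

(* [m] and [l] are the masses and lengths of the string of the moments [s]. *)
Definition moment_string (R : realType) (s m l : nat -> R) : Prop :=
  [/\ forall i, 0 < m i, forall i, 0 < l i, m 0%N = 1 &
      forall k, s k = jacobi_moment (string_a m l) (string_b m l) k].

Definition string_mass (R : realType) (m : nat -> R) : \bar R :=
  (\sum_(0 <= k <oo) (m k)%:E)%E.

Definition string_length (R : realType) (l : nat -> R) : \bar R :=
  (\sum_(0 <= k <oo) (l k)%:E)%E.

Fixpoint chebT (R : realType) (t : nat) : {poly R} :=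
  match t with
  | 0 => 0
  | t1.+1 => match t1 with
             | 0 => 1
             | t2.+1 => 'X * chebT R t1 - chebT R t2
             end
  end.

Definition response (R : realType) (s : nat -> R) (n : nat) : R :=
  \sum_(k < size (chebT R n.+1)) (chebT R n.+1)`_k * s k.

(* The entry at time t is T_(n-t)(0), for t = 0, ..., n-1. *)
Definition Gamma (R : realType) (n : nat) : 'cV[R]_n :=
  \col_(t < n) (chebT R (n - t)).[0].

Definition connecting_mx (R : realType) (s : nat -> R) (n : nat) : 'M[R]_n :=
  \matrix_(i < n, j < n)
    \sum_(0 <= k < n - maxn i j) response s (`|i - j| + k.*2)%N.

(* The response operator: row t computes the value at time t of
   (R f)_t = \sum_(0 <= s < t) r_s f_(t-1-s).  Rows and columns are both
   indexed by time 0, ..., n-1, as controls and Gamma are, so that the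
   adjoint pairs R f with Gamma at equal times.  The value (R f)_0 = 0 is
   included, and the value at time n is absent: it is paired with
   T_0(0) = 0. *)
Definition response_mx (R : realType) (s : nat -> R) (n : nat) : 'M[R]_n :=
  \matrix_(t < n, j < n) (if (j < t)%N then response s (t.-1 - j)%N else 0).

Definition mass_form (R : realType) (s : nat -> R) (n : nat) : R :=
  inner (invmx (connecting_mx s n) *m Gamma R n) (Gamma R n).

Definition e1 (R : realType) (n : nat) : 'cV[R]_n.+1 := delta_mx 0 0.

(* Here K = n.+1.  This quotient is Q_(K-1)(0) / P_(K-1)(0), where P_k are the
   orthonormal polynomials and Q_k those of the second kind; for a string it is
   - (l_1 + ... + l_(K-1)), e.g. - l_1 for K = 2. *)
Definition length_quotient (R : realType) (s : nat -> R) (n : nat) : R :=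
  inner (invmx (connecting_mx s n.+1) *m
           ((response_mx s n.+1)^T *m Gamma R n.+1)) (e1 R n)
  / inner (invmx (connecting_mx s n.+1) *m Gamma R n.+1) (e1 R n).

(* Main.v *)
Require Import Defs.
From HB Require Import structures.
From mathcomp Require Import all_boot all_order all_algebra.
From mathcomp Require Import all_classical all_reals all_analysis.
From mathcomp Require Import measurable_realfun.
From mathcomp Require Import ring lra zify.
From mathcomp Require polyrcf.

Set Implicit Arguments.
Unset Strict Implicit.
Unset Printing Implicit Defensive.

Import Order.TTheory GRing.Theory Num.Theory.
Import numFieldNormedType.Exports.

Local Open Scope classical_set_scope.
Local Open Scope ring_scope.

(* Let S be the moment functional, Y_i the orthogonal polynomials normalized by
   Y_i(0) = 1 and Z_i = sum_(j <= i) m_j Y_j; the string equation reads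
   Y_(i+1) = Y_i - l_i x Z_i, and S(Y_i Y_j) = [i = j] / m_i,
   S(x Z_i Z_j) = [i = j] / l_i.  The connecting matrix is the Gram matrix of
   the Chebyshev-like polynomials, so the two quotients are exactly the partial
   sums of the masses and of the lengths; it remains to see that the problem is
   indeterminate iff both sums are finite.

   If rho_1, rho_2 are distinct solutions, the integrals of (1 + x)^-n differ
   for some n, because polynomials in 1 / (1 + x) converge boundedly to
   indicators of half-lines.  For the least such n, with difference D, division
   by 1 + x gives int p (1 + x)^-n d(rho_1 - rho_2) = p(-1) D for every
   polynomial p, hence |D| |p(-1)| <= S(p) when p >= 0 on the half-line.  Taking
   for p the squares of the kernels of the Y_i and x times those of the Z_i at
   -1, where all Y_i, Z_i are at least 1, bounds the masses and the lengths.

   If both sums are finite, then for every large c the sequence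
   (M c^2, c, s_0, s_1, ...) satisfies the positivity conditions of the Stieltjes
   problem on [0, +oo[; its functional is nonnegative on the polynomials that are
   nonnegative there, extends to a positive functional on functions of polynomial
   growth (M. Riesz), and x^2 times the extension is represented by a measure
   rho, which solves the problem for s and has int (1/x) drho = c.  Different
   values of c give different solutions. *)

(** * The moment functional and the string polynomials *)

Definition mom (R : realType) (s : nat -> R) (p : {poly R}) : R :=
  \sum_(k < size p) p`_k * s k.

(** Coefficients beyond the degree vanish, so polynomials of different sizes can be compared under
    one common bound. *)
Lemma momE (R : realType) (s : nat -> R) (p : {poly R}) (n : nat) :
  (size p <= n)%N -> mom s p = \sum_(k < n) p`_k * s k.
Proof.
move=> pn; rewrite /mom (big_ord_widen n (fun k => p`_k * s k) pn).
rewrite big_mkcond; apply: eq_bigr => k _; case: ltnP => // pk.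
by rewrite nth_default ?mul0r.
Qed.

Lemma mom_is_linear (R : realType) (s : nat -> R) :
  linear_for *%R (mom s).
Proof.
move=> c p q; pose n := maxn (size (c *: p + q)) (maxn (size p) (size q)).
rewrite !(@momE _ _ _ n) ?leq_max ?leqnn ?orbT// mulr_sumr -big_split /=.
by apply: eq_bigr => k _; rewrite coefD coefZ mulrDl mulrA.
Qed.

HB.instance Definition _ (R : realType) (s : nat -> R) :=
  GRing.isLinear.Build R {poly R} R *%R (mom s) (mom_is_linear s).

Lemma momD (R : realType) (s : nat -> R) (p q : {poly R}) :
  mom s (p + q) = mom s p + mom s q.
Proof. exact: raddfD. Qed.

Lemma momN (R : realType) (s : nat -> R) (p : {poly R}) :
  mom s (- p) = - mom s p.
Proof. exact: raddfN. Qed.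

Lemma momB (R : realType) (s : nat -> R) (p q : {poly R}) :
  mom s (p - q) = mom s p - mom s q.
Proof. exact: raddfB. Qed.

Lemma momZ (R : realType) (s : nat -> R) (c : R) (p : {poly R}) :
  mom s (c *: p) = c * mom s p.
Proof. exact: linearZ. Qed.

Lemma mom_sum (R : realType) (s : nat -> R) n (f : 'I_n -> {poly R}) :
  mom s (\sum_(i < n) f i) = \sum_(i < n) mom s (f i).
Proof. exact: raddf_sum. Qed.

Lemma momC (R : realType) (s : nat -> R) (c : R) : mom s c%:P = c * s 0%N.
Proof. by rewrite (@momE _ _ _ 1%N) ?size_polyC_leq1// big_ord1 coefC. Qed.

Lemma mom1 (R : realType) (s : nat -> R) : mom s 1 = s 0%N.
Proof. by rewrite momC mul1r. Qed.

Lemma momXM (R : realType) (s : nat -> R) (p : {poly R}) :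
  mom s ('X * p) = mom (s \o S) p.
Proof.
rewrite (@momE _ _ _ (size p).+1); last first.
  by rewrite mulrC (leq_trans (size_polyMleq _ _))// size_polyX addn2.
rewrite big_ord_recl coefXM mul0r add0r; apply: eq_bigr => k _.
by rewrite coefXM /=.
Qed.

Lemma momXn (R : realType) (s : nat -> R) (k : nat) : mom s 'X^k = s k.
Proof.
elim: k s => [|k IH] s; first by rewrite expr0 mom1.
by rewrite exprS momXM IH.
Qed.

Lemma momDs (R : realType) (s t : nat -> R) (p : {poly R}) :
  mom (fun k => s k + t k) p = mom s p + mom t p.
Proof. by rewrite -big_split; apply: eq_bigr => k _; rewrite mulrDr. Qed.

Lemma momZs (R : realType) (c : R) (s : nat -> R) (p : {poly R}) :
  mom (fun k => c * s k) p = c * mom s p.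
Proof. by rewrite mulr_sumr; apply: eq_bigr => k _; rewrite mulrCA. Qed.

Lemma poly_split0 (R : realType) (p : {poly R}) :
  exists q, p = p.[0]%:P + 'X * q.
Proof.
have /factor_theorem[q pq] : root (p - p.[0]%:P) 0.
  by rewrite rootE hornerD hornerN hornerC subrr.
by exists q; rewrite mulrC -[X in _ * X]subr0 -polyC0 -pq addrC subrK.
Qed.

(** Subtracting the multiple of [f n] that cancels the coefficient of degree [n] lowers the size,
    which drives the induction. *)
Lemma triangular_expansion (R : realType) (f : nat -> {poly R}) (n : nat)
    (p : {poly R}) :
  (forall i, size (f i) = i.+1) -> (size p <= n)%N ->
  exists c : nat -> R, p = \sum_(i < n) c i *: f i.
Proof.
move=> fS; elim: n p => [|n IH] p pn.
  exists (fun=> 0); rewrite big_ord0; apply/eqP.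
  by rewrite -size_poly_eq0 -leqn0.
pose a := p`_n / (f n)`_n.
have fn0 : (f n)`_n != 0.
  have -> : (f n)`_n = lead_coef (f n) by rewrite lead_coefE fS.
  by rewrite lead_coef_eq0 -size_poly_eq0 fS.
have [|c pc] := IH (p - a *: f n).
  apply/leq_sizeP => j; rewrite leq_eqVlt => /predU1P[<-|nj].
    by rewrite coefB coefZ /a divfK ?subrr.
  rewrite coefB coefZ !nth_default ?mulr0 ?subrr// ?fS//.
  exact: leq_trans nj.
exists (fun i => if i == n then a else c i).
rewrite big_ord_recr /= eqxx -[LHS](subrK (a *: f n)) pc; congr (_ + _).
by apply: eq_bigr => i _; rewrite ltn_eqF.
Qed.

Section string_polynomials.
Variables (R : realType) (m l : nat -> R).

(* [stringY i] is the orthogonal polynomial of degree i normalized to take the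
   value 1 at 0, so that P_i = (-1)^i sqrt(m_i) [stringY i], and [stringZ i] is
   the kernel sum_(j <= i) m_j [stringY j], orthogonal for the weight x. *)
Fixpoint stringYZ (i : nat) : {poly R} * {poly R} :=
  if i is i'.+1 then
    let y := (stringYZ i').1 - l i' *: ('X * (stringYZ i').2) in
    (y, (stringYZ i').2 + m i *: y)
  else (1, (m 0%N)%:P).

Definition stringY i := (stringYZ i).1.
Definition stringZ i := (stringYZ i).2.

Lemma stringYS i : stringY i.+1 = stringY i - l i *: ('X * stringZ i).
Proof. by []. Qed.

Lemma stringZS i : stringZ i.+1 = stringZ i + m i.+1 *: stringY i.+1.
Proof. by []. Qed.

Lemma stringY_at0 i : (stringY i).[0] = 1.
Proof.
elim: i => [|i IH]; first by rewrite hornerC.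
by rewrite stringYS !hornerE /= IH mulr0 mul0r subr0.
Qed.

Lemma stringY_sumZ n :
  stringY n = 1 - 'X * \sum_(i < n) l i *: stringZ i.
Proof.
elim: n => [|n IH]; first by rewrite big_ord0 mulr0 subr0.
by rewrite stringYS IH big_ord_recr mulrDr opprD addrA -scalerAr.
Qed.

Hypotheses (m_gt0 : forall i, 0 < m i) (l_gt0 : forall i, 0 < l i).

Lemma stringYZ_size i : size (stringY i) = i.+1 /\ size (stringZ i) = i.+1.
Proof.
elim: i => [|i [IHY IHZ]].
  by rewrite /stringY /stringZ /= size_poly1 size_polyC gt_eqF.
have YS : size (stringY i.+1) = i.+2.
  rewrite stringYS addrC size_polyDl size_polyN size_scale ?gt_eqF//.
    by rewrite mulrC size_mulX ?IHZ// -size_poly_eq0 IHZ.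
  by rewrite mulrC size_mulX ?IHZ ?IHY// -size_poly_eq0 IHZ.
by split=> //; rewrite stringZS addrC size_polyDl size_scale ?gt_eqF// YS ?IHZ.
Qed.

Lemma size_stringY i : size (stringY i) = i.+1.
Proof. by case: (stringYZ_size i). Qed.

Lemma size_stringZ i : size (stringZ i) = i.+1.
Proof. by case: (stringYZ_size i). Qed.

(* At -1 the string equation makes the displacements [stringY] increase. *)
Lemma stringYZ_atN1 (m0 : m 0%N = 1) i :
  1 <= (stringY i).[-1] /\ 1 <= (stringZ i).[-1].
Proof.
elim: i => [|i [IHY IHZ]]; first by rewrite /stringY /stringZ /= !hornerC m0.
have YS : 1 <= (stringY i.+1).[-1].
  have -> : (stringY i.+1).[-1] = (stringY i).[-1] + l i * (stringZ i).[-1].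
    by rewrite stringYS !hornerE /=; ring.
  rewrite (le_trans IHY)// lerDl.
  by apply: mulr_ge0; [exact: ltW|exact: le_trans ler01 _].
split=> //; rewrite stringZS hornerD hornerZ (le_trans IHZ)// lerDl.
by apply: mulr_ge0; [exact: ltW|exact: le_trans ler01 _].
Qed.

End string_polynomials.

(** * Orthogonality relations of the string polynomials *)

Section string_orthogonality.
Variables (R : realType) (s m l : nat -> R).
Hypothesis string_ml : moment_string s m l.

Let m_gt0 i : 0 < m i. Proof. by case: string_ml. Qed.
Let l_gt0 i : 0 < l i. Proof. by case: string_ml. Qed.
Let m0 : m 0%N = 1. Proof. by case: string_ml. Qed.
Let sY := size_stringY m_gt0 l_gt0.
Let sZ := size_stringZ m_gt0 l_gt0.
Let a := string_a m l.
Let b := string_b m l.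

(* The n-th coordinate of p(A) e_1. *)
Let coord (n : nat) (p : {poly R}) : R :=
  mom (fun k => iter k (jacobi a b) (fun n => (n == 0%N)%:R) n) p.

Let coordX n p : coord n ('X * p) = jacobi a b (coord^~ p) n.
Proof.
rewrite /coord momXM /jacobi /=; case: n => [|n].
  by rewrite add0r -!momZs -!momDs; apply: eq_bigr => k _; rewrite /= add0r.
by rewrite -!momZs -!momDs; apply: eq_bigr => k _.
Qed.

Let mom_coord p : mom s p = coord 0 p.
Proof. by apply: eq_bigr => k _; case: string_ml => _ _ _ ->. Qed.

(** P_i(A) e_1 is the basis vector of index i, and Y_i is [e i] times P_i. *)
Let e i : R := (-1) ^+ i / Num.sqrt (m i).

(** Joint induction: the string equation passes from both clauses at i to the first one at i + 1;
    applying A to the basis vector found there gives the second. *)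
Let coord_string i :
  (forall n, coord n (stringY m l i) = e i *+ (n == i)) /\
  (forall n, coord n ('X * stringZ m l i) =
     (e i *+ (n == i) - e i.+1 *+ (n == i.+1)) / l i).
Proof.
have rt i' : Num.sqrt (m i') != 0 by rewrite gt_eqF ?sqrtr_gt0.
have sq i' : m i' = Num.sqrt (m i') ^+ 2 by rewrite sqr_sqrtr// ltW.
have l0 i' : l i' != 0 by rewrite gt_eqF.
have ab i' : a i' = (l i' * (Num.sqrt (m i') * Num.sqrt (m i'.+1)))^-1.
  by rewrite /a /string_a div1r sqrtrM // ltW.
elim: i => [|i [IHY IHZ]].
  have Y0 n : coord n 1 = e 0 *+ (n == 0%N).
    rewrite /coord mom1 /= /e m0 sqrtr1 expr0 divr1.
    by case: (n == 0%N).
  split=> [n|n]; first by rewrite -Y0.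
  rewrite /stringZ /= m0 coordX /jacobi /= !Y0.
  case: n => [|[|n]] /=; rewrite ?Y0 /= ?mulr0n ?mulr1n ?mulr0 ?addr0 ?add0r.
  - by rewrite subr0 /b /string_b m0 mul1r mul1r mulrC.
  - by rewrite ab /e m0 sqrtr1 expr0 expr1; field; rewrite l0 rt.
  - by rewrite oppr0 mul0r.
have YS n : coord n (stringY m l i.+1) = e i.+1 *+ (n == i.+1).
  rewrite stringYS /coord linearB linearZ /= -!/(coord _ _) IHY IHZ.
  by field; rewrite l0.
split=> // n; rewrite stringZS mulrDr -scalerAr /coord linearD linearZ /=.
rewrite -!/(coord _ _) IHZ coordX /jacobi !YS /b /string_b.
have eE j : e j.+1 = - (e j * Num.sqrt (m j) / Num.sqrt (m j.+1)).
  by rewrite /e exprS; field; rewrite !rt.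
(* The tridiagonal matrix sends the basis vector of index i + 1 into rows i, i + 1 and i + 2. In row
   i its contribution cancels the term inherited from X Z_i. *)
have [->|ni] := eqVneq n i.
  have -> : (i == i.+1) = false by lia.
  have -> : (i == i.+2) = false by lia.
  have pred0 : (if i is n'.+1 then a n' * coord n' (stringY m l i.+1)
      else 0) = 0.
    by case: (i) YS => // j YS; rewrite YS (_ : (j == j.+2) = false) ?mulr0//; lia.
  rewrite pred0 !eqxx !mulr0n !mulr1n mulr0 (sq i.+1) ab eE.
  by field; rewrite l0 !rt l0.
have [->|ni1] := eqVneq n i.+1.
  rewrite YS.
  have -> : (i == i.+1) = false by lia.
  have -> : (i.+2 == i.+1) = false by lia.
  have -> : (i.+1 == i.+2) = false by lia.
  rewrite !mulr0n mulr1n; field.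
  by rewrite !l0 gt_eqF.
have [->|ni2] := eqVneq n i.+2.
  rewrite YS.
  have -> : (i.+3 == i.+1) = false by lia.
  rewrite !eqxx !mulr0n !mulr1n (sq i.+1) ab (eE i.+1).
  by rewrite !mulr0; field; rewrite !l0 !rt.
have -> : (n.+1 == i.+1) = false by lia.
have -> : (if n is n'.+1 then a n' * coord n' (stringY m l i.+1) else 0) = 0.
  by case: n ni2 {ni ni1} => // j; rewrite YS eqSS => /negbTE ->; rewrite mulr0.
by rewrite !mulr0n; ring.
Qed.

(** Y_i(A) e_1 sits at index i, and each factor A moves the support by at most one index, so fewer
    than i factors cannot reach index 0. *)
Lemma mom_stringY_orthogonal i (p : {poly R}) :
  (size p <= i)%N -> mom s (p * stringY m l i) = 0.
Proof.
move=> pi.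
have supp k n : (n + k < i)%N -> coord n ('X^k * stringY m l i) = 0.
  elim: k n => [|k IH] n nki.
    by rewrite mul1r (proj1 (coord_string i)) (_ : (n == i) = false)//; lia.
  rewrite exprS -mulrA coordX /jacobi !IH; [|lia..].
  case: n nki => [|n] nki; first by rewrite !mulr0 !addr0.
  by rewrite IH ?mulr0 ?addr0//; lia.
have -> : p * stringY m l i = \sum_(k < size p) p`_k *: ('X^k * stringY m l i).
  rewrite -[in LHS](coefK p) poly_def mulr_suml.
  by apply: eq_bigr => k _; rewrite scalerAl.
rewrite linear_sum big1// => k _; rewrite linearZ /= mom_coord supp ?mulr0//.
by rewrite add0n (leq_trans (ltn_ord k)).
Qed.

Lemma mom_XZ_orthogonal i (p : {poly R}) :
  (size p <= i)%N -> mom s (p * ('X * stringZ m l i)) = 0.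
Proof.
move=> pi.
have -> : p * ('X * stringZ m l i) =
    (l i)^-1 *: (p * stringY m l i) - (l i)^-1 *: (p * stringY m l i.+1).
  rewrite stringYS mulrBr scalerBr opprB addrC subrK -scalerAr scalerA.
  by rewrite mulVf ?gt_eqF// scale1r.
rewrite raddfB /= !linearZ /= !mom_stringY_orthogonal//; last exact: leqW.
by rewrite oppr0 mulr0 scaler0 addr0.
Qed.

(** S(X Z_i^2) equals both m_i S(Y_i^2) / l_i and m_(i+1) S(Y_(i+1)^2) / l_i, so m_i S(Y_i^2) does
    not depend on i. *)
Lemma mom_stringY_norm i : mom s (stringY m l i * stringY m l i) = (m i)^-1.
Proof.
have YZ j : mom s ('X * stringZ m l j * stringZ m l j) =
    m j / l j * mom s (stringY m l j * stringY m l j).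
  have XZ : 'X * stringZ m l j = (l j)^-1 *: (stringY m l j - stringY m l j.+1).
    by rewrite stringYS opprB addrC subrK scalerA mulVf ?gt_eqF// scale1r.
  rewrite XZ -scalerAl linearZ /= mulrBl linearB /=.
  rewrite (mulrC (stringY m l j.+1)) (@mom_stringY_orthogonal j.+1) ?sZ//.
  rewrite subr0.
  case: j {XZ} => [|j]; first by rewrite /stringY /stringZ /= m0 !mulr1; ring.
  rewrite stringZS mulrDr linearD /= (mulrC (stringY m l j.+1)).
  rewrite (@mom_stringY_orthogonal j.+1 (stringZ m l j)) ?sZ//.
  rewrite add0r -scalerAr linearZ /=.
  by rewrite mulrCA mulrA.
elim: i => [|i IH].
  rewrite /stringY /= mulr1 mom1 m0 invr1.
  by case: string_ml => _ _ _ ->.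
apply: (mulfI (x := m i.+1)); rewrite ?gt_eqF// divff ?gt_eqF//.
have NY : mom s (stringY m l i.+1 * stringY m l i.+1) =
    - l i * mom s (stringY m l i.+1 * ('X * stringZ m l i)).
  rewrite {2}stringYS mulrBr linearB /= -scalerAr linearZ /= mulNr.
  by rewrite mulrC mom_stringY_orthogonal ?sY// sub0r.
have KZ : mom s ('X * stringZ m l i * stringZ m l i) =
    - m i.+1 * mom s (stringY m l i.+1 * ('X * stringZ m l i)).
  have := @mom_XZ_orthogonal i.+1 (stringZ m l i) _.
  rewrite sZ// => /(_ (leqnn _)).
  rewrite stringZS !mulrDr linearD /= -!scalerAr linearZ /= => /eqP.
  rewrite addr_eq0 mulNr mulrC => /eqP ->; congr (- (_ * mom s _)).
  by rewrite mulrCA mulrA mulrC.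
have -> : m i.+1 * mom s (stringY m l i.+1 * stringY m l i.+1) =
    l i * mom s ('X * stringZ m l i * stringZ m l i) by rewrite NY KZ; ring.
by rewrite YZ IH; field; rewrite !gt_eqF.
Qed.

Lemma mom_stringY_mul i j :
  mom s (stringY m l i * stringY m l j) = (i == j)%:R / m i.
Proof.
have [->|] := eqVneq i j; first by rewrite mom_stringY_norm mul1r.
by rewrite neq_ltn => /orP[] ij; [|rewrite mulrC];
  rewrite mom_stringY_orthogonal ?mul0r ?sY.
Qed.

(** On the diagonal X Z_j is (Y_j - Y_(j+1)) / l_j, and only the term m_j Y_j of Z_j pairs
    nontrivially with it. *)
Lemma mom_XZ_mul i j :
  mom s ('X * (stringZ m l i * stringZ m l j)) = (i == j)%:R / l i.
Proof.
wlog ij : i j / (i <= j)%N => [H|].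
  have [/H//|ji] := leqP i j.
  rewrite (mulrC (stringZ m l i)) (H j i (ltnW ji)).
  by rewrite (ltn_eqF ji) (gtn_eqF ji) !mul0r.
rewrite mulrCA; move: ij; rewrite leq_eqVlt => /predU1P[->|ij]; last first.
  by rewrite mom_XZ_orthogonal ?sZ// (ltn_eqF ij) mul0r.
have -> : 'X * stringZ m l j = (l j)^-1 *: (stringY m l j - stringY m l j.+1).
  by rewrite stringYS opprB addrC subrK scalerA mulVf ?gt_eqF// scale1r.
rewrite eqxx -scalerAr linearZ /= mulrBr linearB /= mul1r.
rewrite (@mom_stringY_orthogonal j.+1 (stringZ m l j)) ?sZ// subr0.
case: j => [|j].
  rewrite /stringY /stringZ /= mulr1 m0 mom1 -[RHS]mulr1.
  by case: string_ml => _ _ _ ->.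
rewrite stringZS mulrDl linearD /= mom_stringY_orthogonal ?sZ// add0r.
by rewrite -scalerAl linearZ /= mom_stringY_norm divff ?mulr1 ?gt_eqF.
Qed.

(** Every term of Z_i except m_0 Y_0 is orthogonal to the constants. *)
Lemma mom_stringZ i : mom s (stringZ m l i) = 1.
Proof.
elim: i => [|i IH].
  by rewrite /stringZ /= m0 mom1; case: string_ml => _ _ _ ->.
rewrite stringZS linearD linearZ /= IH -[stringY _ _ _]mul1r.
by rewrite mom_stringY_orthogonal ?mulr0 ?addr0// size_poly1.
Qed.

End string_orthogonality.

(** * The connecting and response matrices *)

Lemma chebTSS (R : realType) t :
  chebT R t.+2 = 'X * chebT R t.+1 - chebT R t.
Proof. by []. Qed.

Lemma size_chebT (R : realType) t : size (chebT R t.+1) = t.+1.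
Proof.
suff [] : size (chebT R t.+1) = t.+1 /\ (size (chebT R t) <= t)%N by [].
elim: t => [|t [IH1 IH2]]; first by rewrite size_poly1 size_poly0.
split; last by rewrite IH1.
rewrite chebTSS size_polyDl mulrC size_mulX -?size_poly_eq0 ?IH1//.
by rewrite size_polyN ltnS (leq_trans IH2).
Qed.

Lemma chebT_at0 (R : realType) t : (chebT R t.+2).[0] = - (chebT R t).[0].
Proof. by rewrite chebTSS hornerD hornerN hornerM hornerX mul0r add0r. Qed.

(** With x = 2 cos u one has T_t(x) = sin(t u) / sin u, and this is a product formula for sines. Two
    consecutive values of q are carried along because the recurrence has three terms. *)
Lemma chebT_addition (R : realType) p q :
  chebT R p.+1 * chebT R q.+1 - chebT R p * chebT R q = chebT R (p + q).+1.
Proof.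
suff [] : chebT R p.+1 * chebT R q.+1 - chebT R p * chebT R q =
      chebT R (p + q).+1 /\
    chebT R p.+1 * chebT R q.+2 - chebT R p * chebT R q.+1 =
      chebT R (p + q).+2 by [].
elim: q => [|q [IH1 IH2]].
  by rewrite addn0 mulr0 subr0 !mulr1 chebTSS; split=> //; rewrite /=; ring.
rewrite !addnS; split=> //.
rewrite (chebTSS _ (p + q).+1) -IH1 -IH2.
rewrite [chebT R q.+3]chebTSS [in X in _ - X]chebTSS [chebT R q.+2]chebTSS.
ring.
Qed.

(** The addition formula telescopes along pairs of indices with fixed difference d; the resulting
    sum is the one that defines the entries of the connecting matrix. *)
Lemma chebT_mul (R : realType) d b :
  chebT R (b + d) * chebT R b = \sum_(k < b) chebT R (d + k.*2).+1.
Proof.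
elim: b => [|b IH]; first by rewrite mulr0 big_ord0.
have := chebT_addition R (b + d) b; rewrite (_ : (b + d + b = d + b.*2)%N).
  by rewrite big_ord_recr -IH => <-; rewrite addSn [RHS]addrC subrK.
by lia.
Qed.

(** The sum is the difference quotient of T_n at 0. Its coefficients are entries of [Gamma], which
    is how the adjoint of the response operator will be recognized. *)
Lemma chebT_diff_quotient (R : realType) n :
  chebT R n = (chebT R n).[0]%:P +
    'X * \sum_(0 <= t < n) (chebT R (n - t)).[0] *: chebT R t.
Proof.
suff [] : chebT R n = (chebT R n).[0]%:P +
    'X * \sum_(0 <= t < n) (chebT R (n - t)).[0] *: chebT R t /\
  chebT R n.+1 = (chebT R n.+1).[0]%:P +
    'X * \sum_(0 <= t < n.+1) (chebT R (n.+1 - t)).[0] *: chebT R t by [].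
elim: n => [|n [IH1 IH2]].
  rewrite big_nil big_nat1 subn0 -[chebT R 0]/0 -[chebT R 1]/1.
  by rewrite horner0 hornerC scaler0 mulr0 !addr0.
have sumS k (F : nat -> {poly R}) :
  \sum_(0 <= t < k.+1) F t = \sum_(0 <= t < k) F t + F k by rewrite big_nat_recr.
split=> //; rewrite !sumS.
rewrite (_ : n.+2 - n.+1 = 1)%N; last by lia.
rewrite (_ : n.+2 - n = 2)%N; last by lia.
rewrite !chebT_at0 -[chebT R 0]/0 -[chebT R 1]/1 horner0 hornerC oppr0.
rewrite scale0r addr0 scale1r.
have -> : \sum_(0 <= t < n) (chebT R (n.+2 - t)).[0] *: chebT R t =
    - \sum_(0 <= t < n) (chebT R (n - t)).[0] *: chebT R t.
  rewrite -sumrN; apply: eq_big_nat => t /andP[_ tn].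
  by rewrite -scaleNr -chebT_at0 (_ : n.+2 - t = (n - t).+2)%N//; lia.
rewrite chebTSS {1}IH1 polyCN; ring.
Qed.

Lemma connecting_mxE (R : realType) (s : nat -> R) n (i j : 'I_n) :
  connecting_mx s n i j = mom s (chebT R (n - i) * chebT R (n - j)).
Proof.
rewrite mxE big_mkord.
have resp k : response s k = mom s (chebT R k.+1) by [].
under eq_bigr do rewrite resp.
rewrite -linear_sum; congr (mom s _).
have := ltn_ord i; have := ltn_ord j.
have [ij|ji] := leqP i j => ln_j ln_i.
  rewrite (_ : (n - i = (n - j) + (j - i))%N); last by lia.
  rewrite chebT_mul (_ : `|i - j|%N = (j - i)%N); last by lia.
  by [].
rewrite mulrC (_ : (n - j = (n - i) + (i - j))%N); last by lia.
by rewrite chebT_mul (_ : `|i - j|%N = (i - j)%N)//; lia.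
Qed.

(** * Coordinates in the basis of orthogonal polynomials *)

Section inverse.
Variables (R : realType) (s m l : nat -> R) (n : nat) (B : 'M[R]_n).
Hypothesis string_ml : moment_string s m l.
Hypothesis B_coords : forall k : 'I_n,
  stringY m l k = \sum_(i < n) B k i *: chebT R (n - i).

Let D : 'M[R]_n := diag_mx (\row_k m k).

(* The connecting matrix is the Gram matrix of the [chebT (n - i)], in which
   [B] contains the coordinates of the orthogonal polynomials. *)
Lemma invmx_connecting : invmx (connecting_mx s n) = B^T *m D *m B.
Proof.
have m0 i : m i != 0 by rewrite gt_eqF//; case: string_ml.
have BCBD : B *m (connecting_mx s n *m B^T *m D) = 1%:M.
  apply/matrixP => k j; rewrite !mulmxA mul_mx_diag !mxE.
  have -> : \sum_j0 (B *m connecting_mx s n) k j0 * B^T j0 j =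
      mom s (stringY m l k * stringY m l j).
    rewrite [in RHS](B_coords j) mulr_sumr linear_sum; apply: eq_bigr => i _.
    rewrite mxE [B^T _ _]mxE -scalerAr linearZ mulrC; congr (_ * _).
    rewrite (B_coords k) mulr_suml linear_sum; apply: eq_bigr => h _.
    by rewrite connecting_mxE -scalerAl linearZ.
  rewrite (mom_stringY_mul string_ml).
  case: (eqVneq k j) => [->|kj]; first by rewrite eqxx mul1r mulVf.
  by rewrite (_ : (k == j :> nat) = false) ?mul0r//; apply/negbTE.
have := mulmx1C BCBD; rewrite -!mulmxA => CBDB.
have Cu : connecting_mx s n \in unitmx by case/mulmx1_unit: CBDB.
by rewrite -[LHS]mulmx1 -CBDB mulKmx.
Qed.

Lemma inner_invmx_connecting (u v : 'cV[R]_n) :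
  inner (invmx (connecting_mx s n) *m u) v =
  \sum_(k < n) m k * (B *m u) k 0 * (B *m v) k 0.
Proof.
have -> : inner (invmx (connecting_mx s n) *m u) v =
    ((B *m v)^T *m (D *m (B *m u))) 0 0.
  rewrite invmx_connecting trmx_mul -!mulmxA [RHS]mxE.
  by apply: eq_bigr => i _; rewrite mulrC [v^T _ _]mxE.
rewrite [LHS]mxE; apply: eq_bigr => k _; rewrite mul_diag_mx.
rewrite [X in X * _]mxE [X in _ * X]mxE [X in _ * (X * _)]mxE.
by rewrite mulrC.
Qed.

(** [Gamma] lists the values at 0 of the basis polynomials, so this coordinate is Y_k(0). *)
Lemma coords_Gamma (k : 'I_n) : (B *m Gamma R n) k 0 = 1.
Proof.
rewrite -(stringY_at0 m l k) B_coords horner_sum mxE.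
by apply: eq_bigr => i _; rewrite mxE hornerZ.
Qed.

(** The coordinate is S applied to the difference quotient (Y_k - 1) / X, which by [stringY_sumZ] is
    minus the sum of the l_i Z_i with i < k; each S(Z_i) is 1. *)
Lemma coords_response_Gamma (k : 'I_n) :
  (B *m ((response_mx s n)^T *m Gamma R n)) k 0 = - \sum_(i < k) l i.
Proof.
(* [U i] is the difference quotient at 0 of [chebT (n - i)]. *)
pose U i := \sum_(t < n - i) (chebT R (n - i - t)).[0] *: chebT R t.
have RG (j : 'I_n) : ((response_mx s n)^T *m Gamma R n) j 0 = mom s (U j).
  pose F t := if (j < t)%N then
    response s (t.-1 - j) * (chebT R (n - t)).[0] else 0.
  rewrite mxE; transitivity (\sum_(0 <= t < n) F t).
    rewrite big_mkord; apply: eq_bigr => t _; rewrite !mxE /F.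
    by case: ifP; rewrite ?mul0r.
  rewrite (big_cat_nat (n := j)) ?(ltnW (ltn_ord j))//=.
  rewrite big_nat big1 ?add0r => [|t /andP[_ tj]]; last first.
    by rewrite /F ltnNge ltnW.
  rewrite -{1}(add0n j : 0 + j = j)%N big_addn linear_sum big_mkord.
  (* The time t = j contributes nothing on either side: the response matrix is strictly lower
     triangular, and T_0 = 0. *)
  apply: eq_bigr => -[[|t] tn] _; rewrite /F /=.
    by rewrite add0n ltnn linearZ /= linear0 mulr0.
  rewrite (_ : (j < t.+1 + j)%N); last by lia.
  rewrite linearZ /= mulrC (_ : (t.+1 + j).-1 - j = t)%N; last by lia.
  by rewrite (_ : (n - j - t.+1 = n - (t.+1 + j))%N)//; lia.
have -> : (B *m ((response_mx s n)^T *m Gamma R n)) k 0 =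
    mom s (\sum_(i < n) B k i *: U i).
  by rewrite linear_sum mxE; apply: eq_bigr => i _; rewrite linearZ RG.
have -> : \sum_(i < n) B k i *: U i = - \sum_(i < k) l i *: stringZ m l i.
  apply: (mulfI (x := 'X)); first by rewrite polyX_eq0.
  apply: (addrI 1); rewrite mulrN -stringY_sumZ B_coords.
  rewrite -[1](_ : \sum_(i < n) B k i *: (chebT R (n - i)).[0]%:P = 1).
    rewrite mulr_sumr -big_split; apply: eq_bigr => i _ /=.
    by rewrite [in RHS]chebT_diff_quotient big_mkord scalerDr -scalerAr.
  have := congr1 (fun p => p.[0]%:P) (B_coords k).
  rewrite /= stringY_at0 polyC1 horner_sum => ->.
  by rewrite rmorph_sum; apply: eq_bigr => i _; rewrite /= hornerZ polyCM mul_polyC.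
transitivity (- \sum_(i < k) mom s (l i *: stringZ m l i)).
  by rewrite momN mom_sum.
congr (- _); apply: eq_bigr => i _.
by rewrite linearZ /= (mom_stringZ string_ml) mulr1.
Qed.

End inverse.

Lemma chebT_coords (R : realType) (m l : nat -> R) n :
  (forall i, 0 < m i) -> (forall i, 0 < l i) ->
  exists B : 'M[R]_n, forall k : 'I_n,
    stringY m l k = \sum_(i < n) B k i *: chebT R (n - i).
Proof.
move=> m_gt0 l_gt0.
have /(_ _)/cid-/all_sig[c cP] : forall k : 'I_n, exists c : nat -> R,
    stringY m l k = \sum_(i < n) c i *: chebT R i.+1.
  move=> k; apply: (@triangular_expansion _ (fun i => chebT R i.+1)).
    exact: size_chebT.
  by rewrite size_stringY.
(* Column i belongs to [chebT (n - i)], whence the reversed index. *)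
exists (\matrix_(k, i) c k (n - i.+1)%N) => k.
rewrite cP (reindex_inj rev_ord_inj); apply: eq_bigr => i _.
rewrite mxE (_ : (rev_ord i).+1 = (n - i)%N)//.
by have := ltn_ord i; rewrite /=; lia.
Qed.

Lemma mass_formE (R : realType) (s m l : nat -> R) n :
  moment_string s m l -> mass_form s n = \sum_(k < n) m k.
Proof.
move=> ml; have [m_gt0 l_gt0 _ _] := ml.
have [B BP] := chebT_coords n m_gt0 l_gt0.
rewrite /mass_form (inner_invmx_connecting ml BP); apply: eq_bigr => k _.
by rewrite !(coords_Gamma BP) !mulr1.
Qed.

(** Only the first basis polynomial, [chebT n.+1], has degree n, so [e1] has a nonzero coordinate at
    Y_n alone. The common factor m_n B_n0 cancels in the quotient. *)
Lemma length_quotientE (R : realType) (s m l : nat -> R) n :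
  moment_string s m l -> length_quotient s n = - \sum_(k < n) l k.
Proof.
move=> ml; have [m_gt0 l_gt0 _ _] := ml.
have [B BP] := chebT_coords n.+1 m_gt0 l_gt0.
have Be k : (B *m e1 R n) k 0 = B k 0.
  rewrite mxE (bigD1 0)//= mxE !eqxx mulr1 big1 ?addr0// => i /negbTE ni.
  by rewrite mxE ni mulr0.
have B0 (k : 'I_n.+1) : B k 0 * (chebT R n.+1)`_n = (stringY m l k)`_n.
  rewrite BP coef_sum big_ord_recl big1 ?addr0 ?subn0 ?coefZ//.
  move=> i _; rewrite coefZ [X in _ * X]nth_default ?mulr0//.
  have : (n.+1 - bump 0 i <= n)%N by rewrite /bump; lia.
  by case: (n.+1 - bump 0 i)%N => [|j]; rewrite ?size_poly0 ?size_chebT.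
have T0 : (chebT R n.+1)`_n != 0.
  have -> : (chebT R n.+1)`_n = lead_coef (chebT R n.+1).
    by rewrite lead_coefE size_chebT.
  by rewrite lead_coef_eq0 -size_poly_eq0 size_chebT.
have Bk0 (k : 'I_n) : B (widen_ord (leqnSn n) k) 0 = 0.
  apply: (mulIf T0); rewrite B0 mul0r nth_default// size_stringY//.
  by rewrite /= ltn_ord.
have Bn0 : B ord_max 0 != 0.
  apply/eqP => Bn0; have := B0 ord_max; rewrite Bn0 mul0r /=.
  have -> : (stringY m l n)`_n = lead_coef (stringY m l n).
    by rewrite lead_coefE size_stringY.
  by move/esym/eqP; rewrite lead_coef_eq0 -size_poly_eq0 size_stringY.
rewrite /length_quotient !(inner_invmx_connecting ml BP) !big_ord_recr /=.
have S0 (F : 'I_n -> R) :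
    \sum_(i < n) F i * (B *m e1 R n) (widen_ord (leqnSn n) i) 0 = 0.
  by rewrite big1// => i _; rewrite Be Bk0 mulr0.
rewrite !S0 !add0r Be (coords_Gamma BP) (coords_response_Gamma ml BP) /=.
by field; rewrite Bn0 gt_eqF.
Qed.

(** * Distinct solutions bound the string *)

Lemma bernoulli_ineq (R : realType) (x : R) n :
  -1 <= x -> 1 + n%:R * x <= (1 + x) ^+ n.
Proof.
move=> x1; elim: n => [|n IH]; first by rewrite mul0r addr0 expr0.
rewrite exprS (le_trans _ (ler_wpM2l _ IH)) -?lerBlDl ?sub0r//.
rewrite -natr1 -subr_ge0.
have -> : (1 + x) * (1 + n%:R * x) - (1 + (n%:R + 1) * x) = n%:R * x ^+ 2.
  by ring.
by rewrite mulr_ge0 ?sqr_ge0.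
Qed.

(** With r the square root of z and 1 + h = 1 / r, Bernoulli's inequality bounds n r^n by 1 / h, and
    a factor r^n is left over. *)
Lemma cvg_natmul_geometric (R : realType) (z : R) :
  0 < z < 1 -> (fun n => n%:R * z ^+ n) @ \oo --> 0.
Proof.
move=> /andP[z0 z1]; pose r := Num.sqrt z.
have r0 : 0 < r by rewrite sqrtr_gt0.
have rz : z = r * r by rewrite -expr2 sqr_sqrtr// ltW.
have r1 : r < 1 by rewrite -[1]sqrtr1 ltr_sqrt.
pose h := r^-1 - 1.
have h0 : 0 < h by rewrite subr_gt0 invf_gt1.
apply: (@squeeze_cvgr _ _ _ _ (fun=> 0) (fun n => h^-1 * r ^+ n)).
- apply: nearW => n; rewrite mulr_ge0 ?exprn_ge0 ?(ltW z0)//=.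
  rewrite rz exprMn mulrA ler_wpM2r ?exprn_ge0 ?(ltW r0)//.
  rewrite -[leRHS]mul1r ler_pdivlMr// mulrAC.
  have : n%:R * h <= r^-1 ^+ n.
    have := @bernoulli_ineq _ h n; rewrite (_ : 1 + h = r^-1); last by rewrite addrC subrK.
    by move=> /(_ (le_trans (lerN10 _) (ltW h0))); apply: le_trans; rewrite lerDr.
  move=> /(ler_wpM2r (exprn_ge0 n (ltW r0))) /le_trans; apply.
  by rewrite -exprMn mulVf ?expr1n// gt_eqF.
- exact: cvg_cst.
- rewrite -[X in _ --> X](mulr0 h^-1); apply: cvgMr.
  by apply: cvg_expr; rewrite gtr0_norm.
Qed.

(** * Polynomials converging to a step on the unit interval *)

Section step_polynomials.
Variables (R : realType) (c : R).
Hypothesis c0 : 0 < c.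

(* The factor n makes the limit 0 at y = c as well. *)
Let k n := (Num.truncn (n%:R * c^-1 ^+ n)).+1.

Let k_gt n : n%:R * c^-1 ^+ n < (k n)%:R.
Proof. by rewrite /k truncnS_gt. Qed.

Let k_le n : (k n)%:R <= n%:R * c^-1 ^+ n + 1.
Proof.
rewrite /k -natr1 lerD2r truncn_le.
by rewrite mulr_ge0// exprn_ge0// invr_ge0 ltW.
Qed.

(** As k is about n c^-n, the product k y^n tends to 0 for y < c and is at least n for y >= c; this
    separates the two ranges. *)
Definition step_poly n : {poly R} := (1 - 'X^n) ^+ k n.

Lemma step_poly_ge0_le1 (y : R) n : 0 < y <= 1 -> 0 <= (step_poly n).[y] <= 1.
Proof.
move=> /andP[y0 y1]; rewrite /step_poly !hornerE /=.
have yn0 : 0 <= 1 - y ^+ n by rewrite subr_ge0 exprn_ile1// ltW.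
rewrite exprn_ge0//= exprn_ile1// lerBlDr lerDl exprn_ge0//.
exact: ltW.
Qed.

Lemma cvg_step_poly (y : R) : 0 < y < 1 ->
  (fun n => (step_poly n).[y]) @ \oo --> ((y < c)%R%:R : R).
Proof.
move=> /andP[y0 y1].
have yn0 n : 0 <= y ^+ n by rewrite exprn_ge0// ltW.
have yn1 n : y ^+ n <= 1 by rewrite exprn_ile1// ltW.
have E n : (step_poly n).[y] = (1 - y ^+ n) ^+ k n.
  by rewrite /step_poly !hornerE.
have [yc|cy] := ltP y c.
- apply: (@squeeze_cvgr _ _ _ _
    (fun n => 1 - (n%:R * (y / c) ^+ n + y ^+ n)) (fun=> 1)).
  + apply: nearW => n; have := @step_poly_ge0_le1 y n.
    rewrite y0 (ltW y1) => /(_ isT) /andP[_ ->]; rewrite andbT E.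
    have := @bernoulli_ineq _ (- y ^+ n) (k n); rewrite lerN2 => /(_ (yn1 n)).
    apply: le_trans; rewrite lerD2l mulrN lerN2.
    apply: (le_trans (ler_wpM2r (yn0 n) (k_le n))).
    by rewrite mulrDl mul1r -mulrA -exprMn [c^-1 * y]mulrC.
  + rewrite -[X in _ --> X]subr0 -[X in _ - X]addr0.
    apply: cvgB; first exact: cvg_cst.
    apply: cvgD; last by apply: cvg_expr; rewrite gtr0_norm.
    by apply: cvg_natmul_geometric; rewrite divr_gt0//= ltr_pdivrMr// mul1r.
  + exact: cvg_cst.
(* With z = y^n, (1 - z)^k (1 + z)^k <= 1, while (1 + z)^k >= 1 + k z >= n. *)
- apply: (@squeeze_cvgr _ _ _ _ (fun=> 0) (fun n => n%:R^-1)).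
  + near=> n; have n0 : 0 < n%:R :> R by rewrite ltr0n; near: n; exists 1%N.
    have := @step_poly_ge0_le1 y n.
    rewrite y0 (ltW y1) => /(_ isT) /andP[-> _]; rewrite andTb E.
    rewrite -[leRHS]mul1r ler_pdivlMr//.
    have nk : n%:R <= 1 + (k n)%:R * y ^+ n.
      apply: (@le_trans _ _ ((k n)%:R * y ^+ n)); last by rewrite lerDr.
      apply: (le_trans _ (ler_wpM2r (yn0 n) (ltW (k_gt n)))).
      rewrite -mulrA -exprMn ler_peMr ?ler0n// exprn_ege1//.
      by rewrite mulrC ler_pdivlMr// mul1r.
    have y1n : 0 <= 1 - y ^+ n by rewrite subr_ge0.
    apply: (le_trans (ler_wpM2l (exprn_ge0 _ y1n) nk)).
    have := @bernoulli_ineq _ (y ^+ n) (k n).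
    move=> /(_ (le_trans (lerN10 _) (yn0 n))).
    move=> /(ler_wpM2l (exprn_ge0 (k n) y1n)) /le_trans; apply.
    rewrite -exprMn exprn_ile1//; first by rewrite mulr_ge0// addr_ge0.
    by rewrite -subr_sqr expr1n lerBlDr lerDl sqr_ge0.
  + exact: cvg_cst.
  + apply/gtr0_cvgV0; last exact: cvgr_idn.
    by near=> n; rewrite ltr0n; near: n; exists 1%N.
Unshelve. all: by end_near. Qed.

End step_polynomials.

Definition pos_itv (R : realType) : set (measurableTypeR R) :=
  `]0, +oo[%classic.
Arguments pos_itv : clear implicits.

Lemma measurable_itvR (R : realType) (i : interval R) :
  @measurable _ (measurableTypeR R) [set` i].
Proof. exact: measurable_itv. Qed.
#[local] Hint Resolve measurable_itvR : core.

Lemma measurable_pos_itv (R : realType) : measurable (pos_itv R).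
Proof. exact: measurable_itv. Qed.
#[local] Hint Resolve measurable_pos_itv : core.

Lemma pos_itvP (R : realType) (x : R) : pos_itv R x -> 0 < x.
Proof. by rewrite /pos_itv /= in_itv /= andbT. Qed.

(** Open right half-lines are stable under intersection, generate the Borel sets and exhaust the
    line. *)
Lemma measure_eq_tails (R : realType)
    (m1 m2 : {measure set (measurableTypeR R) -> \bar R}) :
  (m1 setT < +oo)%E ->
  (forall t : R, m1 `]t, +oo[%classic = m2 `]t, +oo[%classic) ->
  forall B : set (measurableTypeR R), measurable B -> m1 B = m2 B.
Proof.
move=> m1T m12.
refine (@measure_unique _ R (measurableTypeR R) (@RGenOInfty.G R)
  (fun n => `](- n%:R), +oo[%classic) _ _ _ _ m1 m2 _ _).
- exact: RGenOInfty.measurableE.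
- move=> _ _ [x ->] [y ->]; exists (Num.max x y).
  by apply/seteqP; split=> z /=;
    rewrite !in_itv /= !andbT gt_max => /andP.
- by move=> n; exists (- n%:R).
- rewrite -subTset => x _; exists (Num.bound `|x : R|) => //=.
  rewrite in_itv /= andbT ltrNl; apply: le_lt_trans (archi_boundP (normr_ge0 _)).
  by rewrite -normrN ler_norm.
- by move=> _ [t ->].
- by move=> n; apply: le_lt_trans m1T; apply: le_measure; rewrite ?inE//.
Qed.

(** * Integrals against one solution *)

Section solution.
Variables (R : realType) (s : nat -> R).
Variable rho : {measure set (measurableTypeR R) -> \bar R}.
Hypothesis rho_sol : stieltjes_solution s rho.
Let D := pos_itv R.

Lemma solution_fin : (rho setT < +oo)%E.
Proof.
have [_ /(_ 0%N)[_]] := rho_sol.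
under eq_integral do rewrite expr0.
by rewrite integral_cst// mul1e => ->; rewrite ltry.
Qed.

Lemma solution_monomial k :
  rho.-integrable D (fun x => (x ^+ k)%:E) /\
  \int[rho]_(x in D) (x ^+ k) = s k.
Proof.
have [rho0 /(_ k)[ik ek]] := rho_sol.
split; first exact: (integrableS measurableT).
rewrite /Rintegral.
have := negligible_integral (measurable_itvR `]-oo, 0]) measurableT ik rho0.
by rewrite ek setTD setCitvl => <-.
Qed.

Lemma solution_poly p :
  rho.-integrable D (EFin \o horner p) /\
  \int[rho]_(x in D) p.[x] = mom s p.
Proof.
rewrite /mom; move: (size p) (horner_coef p) => n pE.
have -> : horner p = fun x => \sum_(i < n) p`_i * x ^+ i by apply/funext.
elim: n {pE} => [|n [IHi IHe]].
  rewrite big_ord0; split.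
    by apply: eq_integrable (integrable0 _ _) => // x _ /=; rewrite big_ord0.
  by under eq_Rintegral do rewrite big_ord0; rewrite Rintegral_cst// mul0r.
have [ni ne] := solution_monomial n.
have nZ : rho.-integrable D (EFin \o (fun x => p`_n * x ^+ n)).
  by apply: eq_integrable (integrableZl _ p`_n ni) => // x _ /=; rewrite EFinM.
split.
  apply: eq_integrable (integrableD _ IHi nZ) => // x _ /=.
  by rewrite big_ord_recr EFinD.
under eq_Rintegral do rewrite big_ord_recr.
by rewrite RintegralD// IHe RintegralZl// ne big_ord_recr.
Qed.

Lemma measurable_inv1D : measurable_fun D (fun x : R => (1 + x)^-1).
Proof.
apply: open_continuous_measurable_fun; first exact: interval_open.
move=> x /set_mem/pos_itvP x0.
apply: continuousV; first by rewrite gt_eqF// addr_gt0.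
by apply: cvgD; [exact: cvg_cst|exact: cvg_id].
Qed.

Lemma solution_integrable_poly_inv (p : {poly R}) n :
  rho.-integrable D (EFin \o (fun x => p.[x] * (1 + x)^-1 ^+ n)).
Proof.
have [pi _] := solution_poly p.
apply: le_integrable pi => //.
  apply/measurable_EFinP; apply: measurable_funM; first exact: measurable_poly.
  apply: measurable_funX.
  exact: measurable_inv1D.
move=> x /pos_itvP x0 /=; rewrite lee_fin normrM ler_piMr//.
rewrite ger0_norm; last by rewrite exprn_ge0// invr_ge0 addr_ge0// ltW.
rewrite exprn_ile1//; first by rewrite invr_ge0 addr_ge0// ltW.
by rewrite invf_le1 ?addr_gt0// lerDl ltW.
Qed.

Lemma solution_poly_inv_bound (p : {poly R}) n :
  (forall x, 0 < x -> 0 <= p.[x]) ->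
  0 <= \int[rho]_(x in D) (p.[x] * (1 + x)^-1 ^+ n) <= mom s p.
Proof.
move=> p0; apply/andP; split.
  apply: Rintegral_ge0 => x /pos_itvP x0; rewrite mulr_ge0 ?p0// exprn_ge0//.
  by rewrite invr_ge0 addr_ge0// ltW.
have [pi <-] := solution_poly p.
apply: le_Rintegral => //; first exact: solution_integrable_poly_inv.
move=> x /pos_itvP x0; rewrite ler_piMr ?p0// exprn_ile1//.
  by rewrite invr_ge0 addr_ge0// ltW.
by rewrite invf_le1 ?addr_gt0// lerDl ltW.
Qed.

(** The factor [(1 : {poly R}).[x]] keeps the integrals in the shape p (1 + x)^-n in which two
    solutions are compared. *)
Lemma solution_poly_of_inv (q : {poly R}) :
  rho.-integrable D (EFin \o (fun x => q.[(1 + x)^-1])) /\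
  \int[rho]_(x in D) q.[(1 + x)^-1] = \sum_(i < size q)
    q`_i * \int[rho]_(x in D) ((1 : {poly R}).[x] * (1 + x)^-1 ^+ i).
Proof.
have -> : (fun x => q.[(1 + x)^-1]) =
    fun x => \sum_(i < size q) q`_i * (1 + x)^-1 ^+ i.
  by apply/funext => x; rewrite horner_coef.
elim: (size q) => [|n [IHi IHe]].
  rewrite big_ord0; split.
    by apply: eq_integrable (integrable0 _ _) => // x _ /=; rewrite big_ord0.
  by under eq_Rintegral do rewrite big_ord0; rewrite Rintegral_cst// mul0r.
have ni := solution_integrable_poly_inv (q`_n)%:P n.
have ni' : rho.-integrable D (EFin \o (fun x => q`_n * (1 + x)^-1 ^+ n)).
  by apply: eq_integrable ni => // x _ /=; rewrite hornerC.
split.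
  apply: eq_integrable (integrableD _ IHi ni') => // x _ /=.
  by rewrite big_ord_recr EFinD.
under eq_Rintegral do rewrite big_ord_recr.
rewrite RintegralD// IHe big_ord_recr; congr (_ + _).
rewrite -RintegralZl//; last exact: solution_integrable_poly_inv.
by apply: eq_Rintegral => x _; rewrite hornerC mul1r.
Qed.

(** The condition x > t reads 1 / (1 + x) < 1 / (1 + t), and the step polynomials are dominated by
    1, which is integrable. *)
Lemma cvg_integral_step_poly t : 0 <= t ->
  (fun n => \int[rho]_(x in D) ((step_poly (1 + t)^-1 n).[(1 + x)^-1])%:E)%E
    @ \oo --> rho `]t, +oo[%classic.
Proof.
move=> t0; pose A : set (measurableTypeR R) := `]t, +oo[%classic.
have -> : rho A = (\int[rho]_(x in D) (\1_A x)%:E)%E.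
  rewrite integral_indic; [|exact: measurable_itvR|exact: measurable_itvR].
  congr (rho _); rewrite setIidl// => x.
  by rewrite /A /D /pos_itv /= !in_itv /= !andbT; exact: le_lt_trans.
pose g (x : measurableTypeR R) : \bar R := 1%E.
have [||||||_ _ //] := @dominated_convergence _ _ _ rho D _
  (fun n x => ((step_poly (1 + t)^-1 n).[(1 + x)^-1])%:E)
  (fun x => (\1_A x)%:E) g.
- exact: measurable_pos_itv.
- move=> n; have [/integrableP[]] := solution_poly_of_inv (step_poly (1 + t)^-1 n).
  by [].
- apply/measurable_EFinP; apply: measurable_indic.
  exact: measurable_itvR.
- apply: aeW => x /pos_itvP x0; apply: cvg_EFin; first exact: nearW.
  have -> : \1_A x = ((1 + x)^-1 < (1 + t)^-1)%R%:R :> R.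
    have [x1 t1] : 0 < 1 + x /\ 0 < 1 + t.
      by split; [exact: addr_gt0|rewrite ltr_wpDr].
    by rewrite indicE mem_setE /A in_itv /= andbT ltf_pV2// ltrD2l.
  apply: cvg_step_poly; first by rewrite invr_gt0 ltr_wpDr.
  by rewrite invr_gt0 addr_gt0//= invf_lt1 ?addr_gt0// ltrDl.
- have [/= i1 _] := solution_poly 1.
  apply: eq_integrable i1; first exact: measurable_pos_itv.
  by move=> x _ /=; rewrite hornerC.
- apply: aeW => x n /pos_itvP x0; rewrite /g lee_fin.
  have /andP[p0 p1] : 0 <= (step_poly (1 + t)^-1 n).[(1 + x)^-1] <= 1.
    apply: step_poly_ge0_le1.
    by rewrite invr_gt0 addr_gt0//= invf_le1 ?addr_gt0// lerDl ltW.
  by rewrite ger0_norm.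
Qed.

End solution.

(** * Comparison of two solutions *)

Section two_solutions.
Variables (R : realType) (s : nat -> R).
Variables rho1 rho2 : {measure set (measurableTypeR R) -> \bar R}.
Hypotheses (sol1 : stieltjes_solution s rho1) (sol2 : stieltjes_solution s rho2).
Let D := pos_itv R.

Let gap n (p : {poly R}) : R :=
  \int[rho1]_(x in D) (p.[x] * (1 + x)^-1 ^+ n) -
  \int[rho2]_(x in D) (p.[x] * (1 + x)^-1 ^+ n).

(** Writing p = p(-1) + (x + 1) q lowers the exponent for q by one; by induction the gap of q is
    q(-1) times a gap of 1 that vanishes. At exponent 0 all gaps vanish since the moments agree. *)
Let gap_poly n p :
  (forall j, (j < n)%N -> gap j 1 = 0) -> gap n p = p.[-1] * gap n 1.
Proof.
elim: n p => [|n IH] p gap0.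
  have gap00 q : gap 0 q = 0.
    rewrite /gap.
    under eq_Rintegral do rewrite expr0 mulr1.
    under [X in _ - X]eq_Rintegral do rewrite expr0 mulr1.
    by rewrite (solution_poly sol1 q).2 (solution_poly sol2 q).2 subrr.
  by rewrite !gap00 mulr0.
have /factor_theorem[q pq] : root (p - p.[-1]%:P) (-1).
  by rewrite rootE hornerD hornerN hornerC subrr.
have split (rho : {measure set (measurableTypeR R) -> \bar R}) :
    stieltjes_solution s rho ->
    \int[rho]_(x in D) (p.[x] * (1 + x)^-1 ^+ n.+1) =
    p.[-1] * \int[rho]_(x in D) ((1 : {poly R}).[x] * (1 + x)^-1 ^+ n.+1) +
    \int[rho]_(x in D) (q.[x] * (1 + x)^-1 ^+ n).
  move=> sol; have i1 := solution_integrable_poly_inv sol 1 n.+1.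
  have i2 := solution_integrable_poly_inv sol q n.
  have i3 : rho.-integrable D
      (EFin \o (fun x => p.[-1] * ((1 : {poly R}).[x] * (1 + x)^-1 ^+ n.+1))).
    by apply: eq_integrable (integrableZl _ p.[-1] i1).
  rewrite -RintegralZl// -RintegralD//.
  apply: eq_Rintegral => x /set_mem/pos_itvP x0.
  have -> : p.[x] = p.[-1] + q.[x] * (x + 1).
    have := congr1 (fun r => r.[x]) pq.
    rewrite hornerD hornerN hornerC hornerM hornerD hornerN hornerC hornerX.
    by rewrite opprK => <-; rewrite addrC subrK.
  rewrite hornerC exprS; field.
  by rewrite gt_eqF// addr_gt0.
rewrite /gap (split _ sol1) (split _ sol2).
have := IH q (fun j jn => gap0 j (leqW jn)).
rewrite (gap0 n)// mulr0 /gap => /eqP; rewrite subr_eq0 => /eqP ->.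
by rewrite opprD addrACA subrr addr0 mulrBr.
Qed.

(** Polynomials in 1 / (1 + x) then have equal integrals, and step polynomials carry this over to
    the tails from t >= 0. Tails from t < 0 differ from the one at 0 by a null set. *)
Let gap_eq0 : (forall n, gap n 1 = 0) ->
  forall B : set (measurableTypeR R), measurable B -> rho1 B = rho2 B.
Proof.
move=> gap0; apply: measure_eq_tails; first exact: (solution_fin sol1).
have eqq (q : {poly R}) : (\int[rho1]_(x in D) (q.[(1 + x)^-1])%:E =
    \int[rho2]_(x in D) (q.[(1 + x)^-1])%:E)%E.
  have [i1 e1] := solution_poly_of_inv sol1 q.
  have [i2 e2] := solution_poly_of_inv sol2 q.
  rewrite -[LHS]fineK ?integrable_fin_num// -[RHS]fineK ?integrable_fin_num//.
  congr EFin; rewrite [LHS]e1 [RHS]e2; apply: eq_bigr => i _; congr (_ * _).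
  by apply/eqP; rewrite -subr_eq0; apply/eqP; exact: (gap0 i).
have tail0 t : 0 <= t -> rho1 `]t, +oo[%classic = rho2 `]t, +oo[%classic.
  move=> t0; have := cvg_integral_step_poly sol1 t0.
  under [X in X @ _]eq_fun do rewrite eqq.
  move=> c1; exact: (cvg_unique _ c1 (cvg_integral_step_poly sol2 t0)).
move=> t; have [t0|t0] := leP 0 t; first exact: tail0.
have nullD (rho : {measure set (measurableTypeR R) -> \bar R}) :
    stieltjes_solution s rho -> rho `]t, +oo[%classic = rho `]0, +oo[%classic.
  move=> [rho0 _].
  have -> : `]t, +oo[%classic = `]0, +oo[%classic `|` `]t, 0]%classic.
    apply/seteqP; split=> x /=; rewrite !in_itv /= !andbT.
      by move=> ->; case: (ltP 0 x) => H; [left|right].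
    by case=> [|/andP[]//]; exact: lt_trans.
  apply: measureU0; [exact: measurable_itvR|exact: measurable_itvR|].
  apply: subset_measure0 rho0; try exact: measurable_itvR.
  by move=> x /=; rewrite !in_itv /= => /andP[].
by rewrite (nullD _ sol1) (nullD _ sol2) tail0.
Qed.

Lemma distinct_solutions_bound :
  ~ (forall B : set (measurableTypeR R), measurable B -> rho1 B = rho2 B) ->
  exists2 d : R, 0 < d & forall p : {poly R},
    (forall x, 0 < x -> 0 <= p.[x]) -> d * `|p.[-1]| <= mom s p.
Proof.
move=> neq.
have /existsNP[n0 /eqP gn0] : ~ forall n, gap n 1 = 0.
  by move=> /gap_eq0.
have [n gn nmin] := ex_minnP (ex_intro (fun n => gap n 1 != 0) n0 gn0).
exists `|gap n 1|; first by rewrite normr_gt0.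
move=> p p0.
rewrite mulrC -normrM -gap_poly => [|j jn]; last first.
  by apply/eqP; apply: contraTT jn => /nmin; rewrite -leqNgt.
(* Both integrals lie between 0 and S(p), so their difference is at most S(p) in absolute value. *)
have /andP[a0 a1] := solution_poly_inv_bound sol1 n p0.
have /andP[b0 b1] := solution_poly_inv_bound sol2 n p0.
by rewrite /gap ler_norml; apply/andP; split; lra.
Qed.

End two_solutions.

Lemma indeterminate_bound (R : realType) (s : nat -> R) :
  stieltjes_indeterminate s ->
  exists2 d : R, 0 < d & forall p : {poly R},
    (forall x, 0 < x -> 0 <= p.[x]) -> d * `|p.[-1]| <= mom s p.
Proof.
move=> /existsNP[rho1 /existsNP[rho2 /not_implyP[sol1 /not_implyP[sol2 neq]]]].
exact: distinct_solutions_bound sol1 sol2 neq.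
Qed.

(** * Positive functionals on the half-line *)

Lemma horner_ge0_closure (R : realType) (h : {poly R}) (a : R)
    (F : set_system R) : ProperFilter F -> F --> nbhs a ->
  (\forall x \near F, 0 <= h.[x]) -> 0 <= h.[a].
Proof.
move=> PF Fa h0.
have ha : h.[x] @[x --> F] --> h.[a].
  exact: cvg_trans (cvg_app _ Fa) (@continuous_horner R h a).
exact: (cvgr_to_ge ha h0).
Qed.

(** Nonnegativity forces a positive leading coefficient, so p stays at least p(0) from some point
    on, and a compact interval remains. *)
Lemma poly_half_line_min (R : realType) (p : {poly R}) :
  (1 < size p)%N -> (forall x, 0 <= x -> 0 <= p.[x]) ->
  exists2 a, 0 <= a & forall x, 0 <= x -> p.[a] <= p.[x].
Proof.
move=> p1 p0.
have lc_gt0 : 0 < lead_coef p.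
  rewrite lt_neqAle eq_sym lead_coef_eq0 -size_poly_gt0 (ltnW p1) /=.
  rewrite leNgt; apply/negP => lc0.
  have [||n /(_ (Num.max n 0))] := @polyrcf.poly_lim_infty _ (- p) 1.
  - by rewrite lead_coefN oppr_gt0.
  - by rewrite size_polyN.
  rewrite le_max lexx => /(_ isT); rewrite hornerN leNgt => /negP; apply.
  by rewrite (le_lt_trans _ ltr01)// oppr_le0 p0// le_max lexx orbT.
have [n nP] := polyrcf.poly_lim_infty p.[0] lc_gt0 p1.
have [||a] := @EVT_min R (horner p) 0 (Num.max n 0) _ _.
- by rewrite le_max lexx orbT.
- by apply: continuous_subspaceT => x; exact: continuous_horner.
rewrite in_itv /= => /andP[a0 an] amin; exists a => // x x0.
have [xn|xn] := leP x (Num.max n 0); first by rewrite amin// in_itv /= x0.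
rewrite (@le_trans _ _ p.[0])//; first by rewrite amin// in_itv /= le_max !lexx orbT.
by apply: nP; move: xn; rewrite gt_max => /andP[/ltW].
Qed.

(* Subtracting the minimum of a nonnegative polynomial leaves x g or
   (x - a)^2 g with g nonnegative, and both functionals g |-> T (x g) and
   g |-> T ((x - a)^2 g) satisfy the same two positivity conditions. *)
Lemma functional_half_line_ge0 (R : realType) (T : {poly R} -> R)
    (p : {poly R}) :
  linear_for *%R T -> (forall r, 0 <= T (r ^+ 2)) ->
  (forall r, 0 <= T ('X * r ^+ 2)) ->
  (forall x, 0 <= x -> 0 <= p.[x]) -> 0 <= T p.
Proof.
have [n] := ubnP (size p); elim: n T p => // n IH T p.
rewrite ltnS => pn Tlin T2 TX2 p0.
have T1 c : 0 <= c -> 0 <= T c%:P.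
  by move=> c0; rewrite -[c]sqr_sqrtr// rmorphXn.
have TD q r : T (q + r) = T q + T r by rewrite -[q]scale1r Tlin mul1r scale1r.
have [/size1_polyC pE|p1] := leqP (size p) 1.
  by rewrite pE T1// -horner_coef0 p0.
have [a a0 amin] := poly_half_line_min p1 p0.
have /factor_theorem[g pg] : root (p - p.[a]%:P) a.
  by rewrite rootE hornerD hornerN hornerC subrr.
have pE : p = p.[a]%:P + ('X - a%:P) * g by rewrite mulrC -pg addrC subrK.
have pEx x : p.[x] - p.[a] = (x - a) * g.[x].
  by rewrite {1}pE !hornerE addrAC subrr add0r.
have sizeM (q r : {poly R}) : size p = size (q * r) -> (1 < size q)%N ->
    (size r < n)%N.
  move=> pqr q1; apply: leq_trans pn.
  have : size (q * r) != 0%N by rewrite -pqr; case: (size p) p1.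
  rewrite size_poly_eq0 mulf_eq0 => /norP[q0 r0].
  rewrite pqr size_mul// -ltnS prednK ?addn_gt0 ?size_poly_gt0 ?q0//.
  by rewrite -[X in (X < _)%N]addn1 addnC ltn_add2r.
have sizeC (q : {poly R}) : p = p.[a]%:P + q -> size p = size q.
  move=> pq; rewrite pq addrC size_polyDl ?(leq_ltn_trans (size_polyC_leq1 _))//.
  rewrite ltnNge; apply/negP => q1; move: p1; rewrite pq ltnNge => /negP; apply.
  by rewrite (leq_trans (size_polyD _ _))// geq_max size_polyC_leq1.
rewrite pE TD addr_ge0 ?T1 ?p0//.
(* At the endpoint 0 the cofactor g need not vanish. The functional q |-> T (X q) stays positive on
   squares and on X times squares, since X (X r^2) = (X r)^2. *)
have [a_eq0|a_neq0] := eqVneq a 0.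
  move: pE pEx; rewrite a_eq0 polyC0 subr0 => pE pEx.
  apply: (IH (fun q => T ('X * q)) g) => //.
  - apply: (sizeM 'X g); last by rewrite size_polyX.
    by apply: sizeC; rewrite a_eq0.
  - by move=> c q r; rewrite mulrDr -scalerAr Tlin.
  - by move=> r; rewrite mulrA -expr2 -exprMn.
  - move=> x; rewrite le_eqVlt => /predU1P[<-|x0]; last first.
      have := amin x (ltW x0); rewrite -subr_ge0 a_eq0 pEx subr0.
      by rewrite pmulr_rge0.
    apply: (@horner_ge0_closure _ _ _ 0^'+) => //; first exact: cvg_within.
    near=> y; have y0 : 0 < y by near: y; exact: nbhs_right_gt.
    have := amin y (ltW y0); rewrite -subr_ge0 a_eq0 pEx subr0.
    by rewrite pmulr_rge0.
have {a_neq0}a_gt0 : 0 < a by rewrite lt_neqAle eq_sym a_neq0.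
have g_right x : a < x -> 0 <= g.[x].
  move=> ax; have := amin x (le_trans a0 (ltW ax)).
  by rewrite -subr_ge0 pEx pmulr_rge0// subr_gt0.
have g_left x : 0 <= x < a -> g.[x] <= 0.
  move=> /andP[x0 xa]; have := amin x x0.
  by rewrite -subr_ge0 pEx nmulr_rge0// subr_lt0.
(* At an interior minimum g passes from nonpositive to nonnegative values, so a is a double root of
   p - p(a). *)
have ga : root g a.
  rewrite rootE eq_le; apply/andP; split.
    rewrite -oppr_ge0 -hornerN.
    apply: (@horner_ge0_closure _ _ _ a^'-); first exact: cvg_within.
    near=> x; rewrite hornerN oppr_ge0 g_left//; apply/andP; split.
      by near: x; exact: nbhs_left_ge.
    by near: x; exact: nbhs_left_lt.
  apply: (@horner_ge0_closure _ _ _ a^'+); first exact: cvg_within.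
  by near=> x; rewrite g_right//; near: x; exact: nbhs_right_gt.
have /factor_theorem[h gh] := ga.
have Eh : ('X - a%:P) * g = ('X - a%:P) ^+ 2 * h by rewrite gh mulrC -mulrA mulrC expr2.
have hx x : 0 <= x -> x != a -> 0 <= h.[x].
  move=> x0 xa; have := amin x x0; rewrite -subr_ge0 pEx gh hornerM hornerXsubC.
  by rewrite mulrCA -expr2 pmulr_lge0// exprn_even_gt0//= subr_eq0.
rewrite Eh; apply: (IH (fun q => T (('X - a%:P) ^+ 2 * q)) h) => //.
- apply: (sizeM (('X - a%:P) ^+ 2)); last by rewrite size_exp_XsubC.
  by rewrite -Eh; exact: sizeC.
- by move=> c q r; rewrite mulrDr -scalerAr Tlin.
- by move=> r; rewrite -exprMn.
- by move=> r; rewrite mulrCA -exprMn.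
- move=> x x0; have [->|xa] := eqVneq x a; last exact: hx.
  apply: (@horner_ge0_closure _ _ _ a^'+); first exact: cvg_within.
  near=> y; have ay : a < y by near: y; exact: nbhs_right_gt.
  by rewrite hx ?gt_eqF// ltW// (lt_trans a_gt0).
Unshelve. all: by end_near. Qed.

Lemma inf_le_add (R : realType) (A B C : set R) :
  has_lbound A -> B !=set0 -> C !=set0 ->
  (forall b c, B b -> C c -> exists2 a, A a & a <= b + c) ->
  inf A <= inf B + inf C.
Proof.
move=> lA B0 C0 ABC; rewrite -lerBlDr; apply: lb_le_inf => // b Bb.
rewrite lerBlDr -lerBlDl; apply: lb_le_inf => // c Cc.
by rewrite lerBlDl; have [a Aa /(le_trans _)] := ABC b c Bb Cc; apply; exact: ge_inf.
Qed.

Lemma inf_le_scale (R : realType) (A B : set R) (t : R) :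
  0 < t -> has_lbound A -> B !=set0 ->
  (forall b, B b -> exists2 a, A a & a <= t * b) -> inf A <= t * inf B.
Proof.
move=> t0 lA B0 AB; rewrite -ler_pdivrMl//; apply: lb_le_inf => // b Bb.
rewrite ler_pdivrMl//; have [a Aa /(le_trans _)] := AB b Bb; apply.
exact: ge_inf.
Qed.

(** * Linear functionals below a sublinear one *)

Section sublinear.
Variables (R : realType) (V : lmodType R) (E : V -> Prop).
Hypothesis E_lin : forall c x y, E x -> E y -> E (c *: x + y).
Hypothesis E0 : E 0.

Let ED x y : E x -> E y -> E (x + y).
Proof. by move=> Ex Ey; rewrite -[x]scale1r; exact: E_lin. Qed.
Let EZ c x : E x -> E (c *: x).
Proof. by move=> Ex; rewrite -[_ *: _]addr0; exact: E_lin. Qed.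
Let EN x : E x -> E (- x).
Proof. by rewrite -scaleN1r; exact: EZ. Qed.

(** Conditions are imposed only on the subspace [E], which avoids a subtype of functions. The
    scaling inequality, used for t and 1 / t, yields equality. *)
Definition sublinear (q : V -> R) :=
  (forall x y, E x -> E y -> q (x + y) <= q x + q y) /\
  (forall t x, 0 < t -> E x -> q (t *: x) <= t * q x).

Let sublinear0 q : sublinear q -> q 0 = 0.
Proof.
move=> [qD qZ]; apply/eqP; rewrite eq_le; apply/andP; split.
  by have := qZ (1 / 2) 0 _ E0; rewrite scaler0 => /(_ ltac:(lra)); lra.
by have := qD 0 0 E0 E0; rewrite addr0; lra.
Qed.

Let sublinearZ q t x : sublinear q -> 0 <= t -> E x -> q (t *: x) = t * q x.
Proof.
move=> sq; rewrite le_eqVlt => /predU1P[<- _|t0 Ex].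
  by rewrite scale0r mul0r sublinear0.
case: sq => qD qZ; apply/eqP; rewrite eq_le qZ//=.
have := qZ t^-1 (t *: x); rewrite invr_gt0 => /(_ t0 (EZ t Ex)).
by rewrite scalerA mulVf ?gt_eqF// scale1r ler_pdivlMl.
Qed.

Let sublinear_lb q x y : sublinear q -> E x -> E y -> q y - q (- x) <= q (x + y).
Proof.
move=> [qD _] Ex Ey; rewrite lerBlDl.
by have := qD (- x) (x + y) (EN Ex) (ED Ex Ey); rewrite addKr.
Qed.

(** Zorn's lemma: the pointwise infimum of a chain is sublinear, and it is finite because every
    member is at least - p (- x) at x. *)
Let minimal_sublinear p : sublinear p ->
  exists2 q, sublinear q /\ (forall x, E x -> q x <= p x) &
    forall q', sublinear q' -> (forall x, E x -> q' x <= q x) ->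
      forall x, E x -> q x <= q' x.
Proof.
move=> sp; pose T := {q | sublinear q /\ (forall x, E x -> q x <= p x)}.
(* The order is reversed, so that maximal elements are minimal functionals. *)
pose le (q1 q2 : T) := `[< forall x, E x -> sval q2 x <= sval q1 x >].
have t0 : T by exists p.
have [|||[q [sq qp]] qmin] := @ZL_preorder T t0 le.
- by move=> q; apply/asboolP.
- move=> q2 q1 q3 /asboolP h12 /asboolP h23; apply/asboolP => x Ex.
  exact: le_trans (h23 x Ex) (h12 x Ex).
- move=> A totA; have [[a0 Aa0]|/forallNP A0] := pselect (exists a, A a); last first.
    by exists t0 => a /A0.
  pose Q x := [set sval q x | q in A].
  have Q0 x : Q x !=set0 by exists (sval a0 x), a0.
  have Qlb x : E x -> has_lbound (Q x).
    move=> Ex; exists (- p (- x)) => _ [q Aq <-]; case: q Aq => q [sq qp] _ /=.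
    apply: (@le_trans _ _ (- q (- x))); first by rewrite lerN2; exact/qp/EN.
    by have := sublinear_lb sq Ex E0; rewrite addr0 (sublinear0 sq) sub0r.
  have sQ : sublinear (fun x => inf (Q x)).
    split=> [x y Ex Ey|t x t_gt0 Ex].
      apply: inf_le_add => //; first exact/Qlb/ED.
      move=> _ _ [q1 Aq1 <-] [q2 Aq2 <-].
      have [/asboolP q12|/asboolP q21] := totA _ _ Aq1 Aq2.
        exists (sval q2 (x + y)); first by exists q2.
        case: (svalP q2) => -[q2D _] _.
        by rewrite (le_trans (q2D _ _ Ex Ey))// lerD2r q12.
      exists (sval q1 (x + y)); first by exists q1.
      case: (svalP q1) => -[q1D _] _.
      by rewrite (le_trans (q1D _ _ Ex Ey))// lerD2l q21.
    apply: inf_le_scale => //; first exact/Qlb/EZ.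
    move=> _ [q Aq <-]; exists (sval q (t *: x)); first by exists q.
    by case: (svalP q) => -[_ qZ] _; exact: qZ.
  have Qp x : E x -> inf (Q x) <= p x.
    move=> Ex; apply: (@le_trans _ _ (sval a0 x)).
      by apply: ge_inf; [exact: Qlb|exists a0].
    by case: (svalP a0) => _; exact.
  exists (exist (fun q => sublinear q /\ forall x, E x -> q x <= p x)
    (fun x => inf (Q x)) (conj sQ Qp)) => q Aq; apply/asboolP => x Ex /=.
  by apply: ge_inf; [exact: Qlb|exists q].
exists q => // q' sq' q'q.
have q'p x : E x -> q' x <= p x by move=> Ex; exact: le_trans (q'q x Ex) (qp x Ex).
have /asboolP := qmin (exist (fun q => sublinear q /\
  forall x, E x -> q x <= p x) q' (conj sq' q'p)) (asboolT q'q).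
by [].
Qed.

(** This is the Hahn-Banach argument: a minimal sublinear functional is also superadditive, hence
    linear. *)
Lemma sublinear_dominates_linear p : sublinear p ->
  exists2 L : V -> R,
    (forall c x y, E x -> E y -> L (c *: x + y) = c * L x + L y) &
    forall x, E x -> L x <= p x.
Proof.
move=> /minimal_sublinear[q [sq qp] qmin]; exists q => //.
have qsup x y : E x -> E y -> q x + q y <= q (x + y).
  move=> Ex Ey.
  pose Q x := [set q (x + t *: y) - t * q y | t in [set t | 0 <= t]].
  have Q0 z : Q z !=set0 by exists (q (z + 0 *: y) - 0 * q y), 0 => /=.
  have Qlb z : E z -> has_lbound (Q z).
    move=> Ez; exists (- q (- z)) => _ [t /= t0 <-].
    have := sublinear_lb sq Ez (EZ t Ey); rewrite sublinearZ//; lra.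
  (* This functional is at most q and is at most q (x + y) - q y at x. *)
  have sQ : sublinear (fun x => inf (Q x)).
    split=> [u v Eu Ev|t u t0 Eu].
      apply: inf_le_add => //; first exact/Qlb/ED.
      move=> _ _ [t1 /= t10 <-] [t2 /= t20 <-].
      exists (q (u + v + (t1 + t2) *: y) - (t1 + t2) * q y).
        by exists (t1 + t2) => //=; exact: addr_ge0.
      case: (sq) => qD _; have := qD _ _ (ED Eu (EZ t1 Ey)) (ED Ev (EZ t2 Ey)).
      by rewrite addrACA -scalerDl; lra.
    apply: inf_le_scale => //; first exact/Qlb/EZ.
    move=> _ [r /= r0 <-]; exists (q (t *: u + (t * r) *: y) - (t * r) * q y).
      by exists (t * r) => //=; rewrite mulr_ge0// ltW.
    case: (sq) => _ qZ; have := qZ t _ t0 (ED Eu (EZ r Ey)).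
    by rewrite scalerDr scalerA mulrBr mulrA; lra.
  have Qq z : E z -> inf (Q z) <= q z.
    move=> Ez; apply: ge_inf; first exact: Qlb.
    by exists 0 => //=; rewrite scale0r addr0 mul0r subr0.
  rewrite -lerBrDr; apply: le_trans (qmin _ sQ Qq x Ex) _.
  apply: ge_inf; first exact: Qlb.
  by exists 1 => //=; rewrite scale1r mul1r.
have qD x y : E x -> E y -> q (x + y) = q x + q y.
  by move=> Ex Ey; case: (sq) => qD _; apply/eqP; rewrite eq_le qD// qsup.
move=> c x y Ex Ey; rewrite qD//; last exact: EZ.
congr (_ + _); have [c0|c0] := leP 0 c; first exact: sublinearZ.
have := qD (c *: x) (- c *: x) (EZ _ Ex) (EZ _ Ex).
have -> : q (- c *: x) = - c * q x.
  by apply: sublinearZ => //; rewrite oppr_ge0 ltW.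
rewrite -scalerDl subrr scale0r (sublinear0 sq) mulNr => /eqP.
by rewrite eq_sym subr_eq0 => /eqP.
Qed.

End sublinear.

(** * Representation by a measure *)

(** Growth is controlled on the closed half-line only; values at negative arguments are
    unrestricted. *)
Definition polybd (R : realType) (f : R -> R) :=
  exists q : {poly R}, forall x, 0 <= x -> `|f x| <= q.[x].

Lemma polybd_lin (R : realType) c (f g : R -> R) :
  polybd f -> polybd g -> polybd (fun x => c * f x + g x).
Proof.
move=> [p fp] [q gq]; exists (`|c| *: p + q) => x x0.
rewrite hornerD hornerZ (le_trans (ler_normD _ _))// lerD ?gq// normrM.
by rewrite ler_wpM2l ?fp.
Qed.

Lemma polybd_mul (R : realType) (f g : R -> R) :
  polybd f -> polybd g -> polybd (fun x => f x * g x).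
Proof.
move=> [p fp] [q gq]; exists (p * q) => x x0.
by rewrite hornerM normrM ler_pM ?fp ?gq.
Qed.

Lemma polybd_horner (R : realType) (p : {poly R}) : polybd (horner p).
Proof.
(* Every real t satisfies |t| <= t^2 + 1. *)
exists (p ^+ 2 + 1) => x _; rewrite hornerD horner_exp hornerC.
by rewrite ler_norml; apply/andP; split; nra.
Qed.

Lemma polybd_le1 (R : realType) (f : R -> R) :
  (forall x, 0 <= x -> `|f x| <= 1) -> polybd f.
Proof. by move=> f1; exists 1 => x x0; rewrite hornerC f1. Qed.

Lemma polybd_indic (R : realType) (P : pred R) :
  polybd (fun x => (P x)%:R).
Proof. by apply: polybd_le1 => x _; case: (P x); rewrite ?normr0 ?normr1. Qed.

Definition pos_functional (R : realType) (L : (R -> R) -> R) :=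
  (forall c f g, polybd f -> polybd g ->
    L (fun x => c * f x + g x) = c * L f + L g) /\
  (forall f, polybd f -> (forall x, 0 <= x -> 0 <= f x) -> 0 <= L f).

(** The infimum of T over the polynomial majorants of f is sublinear in f. A linear L below it is
    positive, since 0 is a majorant of -f for f >= 0, and it agrees with T on polynomials, since p
    and -p are their own majorants. *)
Lemma riesz_extension (R : realType) (T : {poly R} -> R) :
  linear_for *%R T ->
  (forall p, (forall x, 0 <= x -> 0 <= p.[x]) -> 0 <= T p) ->
  exists2 L, pos_functional L & forall p : {poly R}, L (horner p) = T p.
Proof.
move=> Tlin Tpos.
have TD q r : T (q + r) = T q + T r by rewrite -[q]scale1r Tlin mul1r scale1r.
have T0 : T 0 = 0 by apply/eqP; rewrite -[_ == _](can_eq (addrK (T 0))) -TD !addr0 add0r.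
have TZ c q : T (c *: q) = c * T q by rewrite -[c *: q]addr0 Tlin T0 addr0.
have TN q : T (- q) = - T q by rewrite -scaleN1r TZ mulN1r.
pose Q (f : R -> R^o) :=
  [set T r | r in [set r : {poly R} | forall x, 0 <= x -> f x <= r.[x]]].
have Q0 f : polybd f -> Q f !=set0.
  move=> [q fq]; exists (T q), q => //= x x0.
  by rewrite (le_trans (ler_norm _))// fq.
have Qlb f : polybd f -> has_lbound (Q f).
  move=> [q fq]; exists (- T q) => _ [r /= fr <-].
  rewrite -subr_ge0 opprK -TD Tpos// => x x0; rewrite hornerD.
  by have := fr x x0; have := fq x x0; rewrite ler_norml => /andP[]; lra.
have E_lin c (f g : R -> R^o) : polybd f -> polybd g -> polybd (c *: f + g).
  exact: polybd_lin.
have E0 : polybd (0 : R -> R^o).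
  by exists 0 => x _; rewrite horner0 normr0.
have [|L Llin LQ] := @sublinear_dominates_linear R (R -> R^o) (@polybd R)
    E_lin E0 (fun f => inf (Q f)).
  split=> [f g Ef Eg|c f c0 Ef].
    apply: inf_le_add; [|exact: Q0|exact: Q0|].
      by apply: Qlb; have := E_lin 1 f g Ef Eg; rewrite scale1r.
    move=> _ _ [r1 /= fr1 <-] [r2 /= fr2 <-]; exists (T (r1 + r2)).
      exists (r1 + r2) => //= x x0; rewrite hornerD.
      by apply: lerD; [exact: fr1|exact: fr2].
    by rewrite TD.
  apply: inf_le_scale => //; [|exact: Q0|].
    by apply: Qlb; have := E_lin c f 0 Ef E0; rewrite addr0.
  move=> _ [r /= fr <-]; exists (T (c *: r)); last by rewrite TZ.
  exists (c *: r) => //= x x0; rewrite hornerZ.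
  by apply: ler_wpM2l; [exact: ltW|exact: fr].
have L0 : L 0 = 0.
  by have := Llin 1 0 0 E0 E0; rewrite scaler0 addr0; lra.
have LN f : polybd f -> L (- f) = - L f.
  move=> Ef; have := Llin (-1) f 0 Ef E0.
  by rewrite addr0 L0 addr0 scaleN1r mulN1r.
have LT f (r : {poly R}) : polybd f -> (forall x, 0 <= x -> f x <= r.[x]) -> L f <= T r.
  move=> Ef fr; apply: le_trans (LQ f Ef) _.
  by apply: ge_inf; [exact: Qlb|exists r].
exists L; first split.
- by move=> c f g Ef Eg; exact: Llin.
- move=> f Ef f0; rewrite -oppr_le0 -LN// -T0; apply: LT.
    by have := E_lin (-1) f 0 Ef E0; rewrite scaleN1r addr0.
  by move=> x x0; rewrite horner0 oppr_le0; exact: f0.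
- move=> p; apply/eqP; rewrite eq_le LT//; last exact: polybd_horner.
  rewrite -lerN2 -TN -LN; last exact: polybd_horner.
  apply: LT; last by move=> x _; rewrite hornerN.
  have := E_lin (-1) _ 0 (polybd_horner p) E0; by rewrite scaleN1r addr0.
Qed.

Section pos_functional.
Variables (R : realType) (L : (R -> R) -> R).
Hypothesis L_pos : pos_functional L.

Let L_lin := L_pos.1.

Lemma polybd0 : polybd (fun=> 0 : R).
Proof. by exists 0 => x _; rewrite horner0 normr0. Qed.

Lemma polybdZ c (f : R -> R) : polybd f -> polybd (fun x => c * f x).
Proof.
move=> bf; have := polybd_lin c bf polybd0.
by congr polybd; apply/funext => x; rewrite addr0.
Qed.

Lemma polybdD (f g : R -> R) : polybd f -> polybd g -> polybd (fun x => f x + g x).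
Proof.
move=> bf bg; have := polybd_lin 1 bf bg.
by congr polybd; apply/funext => x; rewrite mul1r.
Qed.

Lemma functional0 : L (fun=> 0) = 0.
Proof.
have := L_lin 1 polybd0 polybd0; rewrite mul1r.
have -> : (fun=> 0 + 0) = (fun=> 0) :> (R -> R).
  by apply/funext => x; rewrite addr0.
lra.
Qed.

Lemma functionalZ c (f : R -> R) : polybd f -> L (fun x => c * f x) = c * L f.
Proof.
move=> bf; have := L_lin c bf polybd0; rewrite functional0 addr0 => <-.
by congr L; apply/funext => x; rewrite addr0.
Qed.

Lemma functionalD (f g : R -> R) : polybd f -> polybd g ->
  L (fun x => f x + g x) = L f + L g.
Proof.
move=> bf bg; have := L_lin 1 bf bg; rewrite mul1r => <-.
by congr L; apply/funext => x; rewrite mul1r.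
Qed.

Lemma le_functional (f g : R -> R) : polybd f -> polybd g ->
  (forall x, 0 <= x -> f x <= g x) -> L f <= L g.
Proof.
move=> bf bg fg; rewrite -subr_ge0 -mulN1r addrC -L_lin//.
apply: L_pos.2; first exact: polybd_lin.
by move=> x x0; rewrite mulN1r addrC subr_ge0 fg.
Qed.

Lemma polybd_sum n (c : nat -> R) (f : nat -> R -> R) :
  (forall i, polybd (f i)) -> polybd (fun x => \sum_(i < n) c i * f i x).
Proof.
move=> bf; elim: n => [|n IH].
  have := polybd0; congr polybd; apply/funext => x.
  by rewrite big_ord0.
have := polybdD IH (polybdZ (c n) (bf n)).
by congr polybd; apply/funext => x; rewrite big_ord_recr.
Qed.

Lemma functional_sum n (c : nat -> R) (f : nat -> R -> R) :
  (forall i, polybd (f i)) ->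
  L (fun x => \sum_(i < n) c i * f i x) = \sum_(i < n) c i * L (f i).
Proof.
move=> bf; elim: n => [|n IH].
  rewrite big_ord0 -[RHS]functional0; congr L; apply/funext => x.
  by rewrite big_ord0.
rewrite big_ord_recr -IH /= -functionalZ// -functionalD//; last 2 first.
- exact: polybd_sum.
- exact: polybdZ.
by congr L; apply/funext => x; rewrite big_ord_recr.
Qed.

End pos_functional.

(** * Step functions enclosing a monotone function *)

Section step_functions.
Variables (R : realType) (g : R -> R) (X : nat -> R).
Hypotheses (X0 : X 0%N = 0) (X_nd : forall i, X i <= X i.+1).
Hypotheses (g0 : g 0 = 0).
Hypothesis g_nd : forall x y, 0 <= x -> x <= y -> g x <= g y.

Definition step_incr i := g (X i.+1) - g (X i).

(** For X_k < x <= X_(k+1) with k < n, the sums telescope to g(X_k) here and to g(X_(k+1)) in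
    [upper_step]. Indicators of open right half-lines are used because their values under L are
    compared with tails. *)
Definition lower_step n x := \sum_(i < n) step_incr i * (X i.+1 < x)%R%:R.

Definition upper_step n x := \sum_(i < n) step_incr i * (X i < x)%R%:R.

Let X_ge0 i : 0 <= X i.
Proof. by elim: i => [|i IH]; rewrite ?X0// (le_trans IH). Qed.

Lemma step_incr_ge0 i : 0 <= step_incr i.
Proof. by rewrite subr_ge0 g_nd. Qed.

Lemma lower_step_ge0 n x : 0 <= lower_step n x.
Proof. by apply: sumr_ge0 => i _; rewrite mulr_ge0 ?step_incr_ge0. Qed.

Lemma lower_step_le n x : 0 <= x -> lower_step n x <= g x.
Proof.
(* The induction needs the sharper bound by g at the truncated point min(x, X n). *)
move=> x0; apply: (@le_trans _ _ (g (Num.min x (X n)))); last first.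
  by rewrite g_nd ?ge_min ?lexx// le_min x0 X_ge0.
elim: n => [|n IH].
  by rewrite /lower_step big_ord0 X0 (min_idPr x0) g0.
rewrite /lower_step big_ord_recr -/(lower_step n x) /=.
have [xX|Xx] := ltP (X n.+1) x.
  move: IH; rewrite (min_idPr (le_trans (X_nd n) (ltW xX))).
  by rewrite mulr1 /step_incr; lra.
rewrite mulr0 addr0 (le_trans IH)// g_nd ?le_min ?x0 ?X_ge0//.
by rewrite ge_min lexx.
Qed.

Lemma upper_step_ge n x : 0 <= x <= X n -> g x <= upper_step n x.
Proof.
move=> /andP[x0 xn]; rewrite -[in g x](min_idPl xn) {xn}.
elim: n => [|n IH].
  by rewrite /upper_step big_ord0 X0 (min_idPr x0) g0.
rewrite /upper_step big_ord_recr -/(upper_step n x) /=.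
have [xX|Xx] := ltP (X n) x.
  move: IH; rewrite (min_idPr (ltW xX)) mulr1 => IH.
  have : g (Num.min x (X n.+1)) <= g (X n.+1).
    by rewrite g_nd ?le_min ?x0 ?X_ge0// ge_min lexx orbT.
  by rewrite /step_incr; lra.
rewrite mulr0 addr0 (min_idPl (le_trans Xx (X_nd n))).
by move: IH; rewrite (min_idPl Xx).
Qed.

Lemma upper_step_le n x w : 0 <= w -> (forall i, (i < n)%N -> step_incr i <= w) ->
  upper_step n x <= lower_step n x + w.
Proof.
move=> w0 stepw.
(* To the right of X n the upper sum does not exceed the lower one, so a single increment has to be
   paid for. *)
suff [] : upper_step n x <= lower_step n x + w /\
  (X n < x -> upper_step n x <= lower_step n x) by [].
elim: n stepw => [|n IH] stepw.
  by rewrite /upper_step /lower_step !big_ord0 add0r.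
have [|IH1 IH2] := IH _; first by move=> i ni; rewrite stepw// leqW.
rewrite /upper_step /lower_step !big_ord_recr.
rewrite -/(upper_step n x) -/(lower_step n x) /=.
have := stepw n (leqnn _); have := step_incr_ge0 n.
have [xX|Xx] := ltP (X n.+1) x.
  have Xn := le_lt_trans (X_nd n) xX; rewrite Xn !mulr1.
  by move: (IH2 Xn); split; lra.
have [Xn|nX] := ltP (X n) x; rewrite ?mulr1 ?mulr0.
  by move: (IH2 Xn) => *; split=> [|//]; lra.
by move=> *; split=> [|//]; lra.
Qed.

End step_functions.

Lemma ler_add_invn (R : realType) (a b C : R) :
  (forall n, a <= b + C / n.+1%:R) -> a <= b.
Proof.
move=> H; rewrite leNgt; apply/negP => ba.
have := H (Num.truncn (C / (a - b))); apply/negP; rewrite -ltNge -ltrBrDl.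
rewrite ltr_pdivrMr// mulrC -ltr_pdivrMr ?subr_gt0//.
exact: truncnS_gt.
Qed.

(** * A positive functional as an integral *)

Section representation.
Variables (R : realType) (L : (R -> R) -> R).
Variable mu : {measure set (measurableTypeR R) -> \bar R}.
Let D := pos_itv R.
Let tail t : R := fine (mu `]t, +oo[%classic).
Let ind t (x : R) : R := (t < x)%R%:R.
Hypotheses (L_pos : pos_functional L) (L1 : L (fun=> 1) = 1).
Hypothesis muT : mu setT = 1%E.
(** L need not respect monotone limits, so the tails of [mu] match [L (ind t)] only up to a
    one-sided limit; hence the strict x < y. *)
Hypothesis tail_ge : forall x y, 0 <= x -> x < y -> L (ind y) <= tail x.
Hypothesis tail_le : forall x, 0 <= x -> tail x <= L (ind x).

Let mu_le1 (B : set (measurableTypeR R)) : measurable B -> (mu B <= 1)%E.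
Proof. by move=> mB; rewrite -muT le_measure ?inE. Qed.

Let integral_ind t : 0 <= t -> mu.-integrable D (EFin \o ind t) /\
  \int[mu]_(x in D) ind t x = tail t.
Proof.
move=> t0; pose A : set (measurableTypeR R) := `]t, +oo[%classic.
have -> : ind t = \1_A.
  by apply/funext => x; rewrite indicE mem_setE /A in_itv /= andbT.
have AD : A `&` D = A.
  apply: setIidl => x; rewrite /A /D /pos_itv /= !in_itv /= !andbT.
  exact: le_lt_trans.
have eA : (\int[mu]_(x in D) (\1_A x)%:E = mu A)%E.
  rewrite integral_indic; [|exact: measurable_itvR|exact: measurable_itvR].
  by rewrite AD.
split; last by rewrite /Rintegral eA.
apply/integrableP; split.
  apply/measurable_EFinP; apply: measurable_indic.
  exact: measurable_itvR.
under eq_integral => x _ do rewrite /= ger0_norm//.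
rewrite eA; apply: le_lt_trans (mu_le1 _) (ltry _).
exact: measurable_itvR.
Qed.

Let integral_sum_ind n (c t : nat -> R) : (forall i, 0 <= t i) ->
  mu.-integrable D (EFin \o (fun x => \sum_(i < n) c i * ind (t i) x)) /\
  \int[mu]_(x in D) (\sum_(i < n) c i * ind (t i) x) =
    \sum_(i < n) c i * tail (t i).
Proof.
move=> t0; elim: n => [|n [IHi IHe]].
  rewrite big_ord0; split.
    apply: eq_integrable (integrable0 _ _); first exact: measurable_pos_itv.
    by move=> x _ /=; rewrite big_ord0.
  by under eq_Rintegral do rewrite big_ord0; rewrite Rintegral_cst// mul0r.
have [ni ne] := integral_ind (t0 n).
have nZ : mu.-integrable D (EFin \o (fun x => c n * ind (t n) x)).
  by apply: eq_integrable (integrableZl _ (c n) ni).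
split.
  apply: eq_integrable (integrableD _ IHi nZ) => // x _ /=.
  by rewrite big_ord_recr EFinD.
under eq_Rintegral do rewrite big_ord_recr.
by rewrite RintegralD// IHe RintegralZl// ne big_ord_recr.
Qed.

Let polybd_ind t : polybd (ind t).
Proof. exact: (polybd_indic (fun x => t < x)). Qed.

Let integral_cst_le w : 0 <= w ->
  mu.-integrable D (EFin \o (fun=> w)) /\ \int[mu]_(x in D) w <= w.
Proof.
move=> w0; split.
  have [i1 _] := integral_ind (lexx 0).
  apply: eq_integrable (integrableZl _ w i1) => // x /set_mem/pos_itvP x0 /=.
  by rewrite /ind x0 mule1.
have D1 := mu_le1 (@measurable_pos_itv R).
rewrite Rintegral_cst// ler_piMr// -lee_fin fineK//.
by rewrite ge0_fin_numE// (le_lt_trans D1)// ltry.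
Qed.

Section monotone_test_function.
Variable g : R -> R.
Hypotheses (g_meas : measurable_fun D g) (g0 : g 0 = 0) (g_bd : polybd g).
Hypothesis g_nd : forall x y, 0 <= x -> x <= y -> g x <= g y.
Hypothesis g_lip : forall A, exists K, forall x y,
  0 <= x -> x <= y -> y <= A -> g y - g x <= K * (y - x).

Let g_ge0 x : 0 <= x -> 0 <= g x.
Proof. by move=> x0; rewrite -g0 g_nd. Qed.

(** On a grid of mesh A / (N + 1) the Lipschitz bound makes each increment at most C / (N + 1), and
    beyond A one has g(x) <= x g(x) / A. The factor 2 pays once for g against the lower steps and
    once for the upper against the lower steps. *)
Let grid_bounds A : 0 < A -> exists2 C, 0 <= C & forall N,
  exists2 low : R -> R,
    [/\ mu.-integrable D (EFin \o low), forall x, 0 <= low x,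
      forall x, 0 <= x -> low x <= g x &
      forall x, 0 <= x <= A -> g x <= low x + C / N.+1%:R] &
    \int[mu]_(x in D) low x <= L g /\
    L g <= \int[mu]_(x in D) low x + 2 * C / N.+1%:R + L (fun x => x * g x) / A.
Proof.
move=> A0; have [K gK] := g_lip A.
exists (Num.max K 0 * A) => [|N].
  by rewrite mulr_ge0 ?(ltW A0)// le_max lexx orbT.
pose X i : R := i%:R * (A / N.+1%:R).
have h0 : 0 < A / N.+1%:R by rewrite divr_gt0.
have X0 : X 0%N = 0 by rewrite /X mul0r.
have X_lt i : X i < X i.+1 by rewrite /X ltr_pM2r// ltr_nat.
have X_nd i : X i <= X i.+1 by exact: ltW.
have X_ge0 i : 0 <= X i by rewrite mulr_ge0// ltW.
have XN : X N.+1 = A by rewrite /X mulrC divfK.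
pose low := lower_step g X N.+1; pose up := upper_step g X N.+1.
pose w := Num.max K 0 * A / N.+1%:R.
have w0 : 0 <= w by rewrite /w -mulrA mulr_ge0 ?(ltW h0)// le_max lexx orbT.
have stepw i : (i < N.+1)%N -> step_incr g X i <= w.
  move=> iN; apply: (le_trans (gK _ _ (X_ge0 i) (X_nd i) _)).
    by rewrite -XN /X ler_pM2r// ler_nat.
  have -> : X i.+1 - X i = A / N.+1%:R by rewrite /X -mulrBl -natrB// subSnn mul1r.
  by rewrite /w -mulrA ler_wpM2r ?(ltW h0)// le_max lexx.
have [low_i low_e] := @integral_sum_ind N.+1 (step_incr g X) (X \o S) (fun i => X_ge0 i.+1).
have [up_i up_e] := @integral_sum_ind N.+1 (step_incr g X) X X_ge0.
have low_bd : polybd low by exact: (@polybd_sum _ N.+1 _ (fun i => ind (X i.+1))).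
have low_L : L low = \sum_(i < N.+1) step_incr g X i * L (ind (X i.+1)).
  exact: (@functional_sum _ L L_pos N.+1 (step_incr g X) (fun i => ind (X i.+1))).
have [cst_i cst_e] := integral_cst_le w0.
exists low; split => //.
- exact: lower_step_ge0.
- by move=> x x0; exact: lower_step_le.
- move=> x xA; apply: (@le_trans _ _ (up x)).
    by apply: upper_step_ge => //; rewrite XN.
  exact: upper_step_le.
- apply: (@le_trans _ _ (L low)); last first.
    apply: (le_functional L_pos) => // x x0; exact: lower_step_le.
  rewrite low_e low_L; apply: ler_sum => i _.
  by apply: ler_wpM2l; [exact: step_incr_ge0|exact: tail_le (X_ge0 i.+1)].
- have xg_bd : polybd (fun x => x * g x).
    apply: polybd_mul => //; have := polybd_horner ('X : {poly R}).
    by congr polybd; apply/funext => x; rewrite hornerX.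
  have Lg : L g <= L low + w + L (fun x => x * g x) / A.
    have bd1 : polybd (fun=> w).
      by have := polybd_horner w%:P; congr polybd; apply/funext => x; rewrite hornerC.
    have bd2 : polybd (fun x => A^-1 * (x * g x)) by exact: polybdZ.
    have Lw : L (fun=> w) = w.
      have b1 : polybd (fun=> 1 : R) by apply: polybd_le1 => x _; rewrite normr1.
      by have := functionalZ L_pos w b1; rewrite L1 !mulr1.
    rewrite -[X in _ + X + _]Lw [_ / A]mulrC -(functionalZ L_pos)// -(functionalD L_pos)//.
    rewrite -(functionalD L_pos)//; last exact: polybdD.
    apply: (le_functional L_pos) => //; first exact: polybdD (polybdD _ _) _.
    move=> x x0; have [xA|Ax] := leP x A.
      have : 0 <= A^-1 * (x * g x) by rewrite !mulr_ge0 ?g_ge0// invr_ge0 ltW.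
      have : g x <= low x + w.
        apply: (@le_trans _ _ (up x)); last exact: upper_step_le.
        by apply: upper_step_ge => //; rewrite XN x0.
      lra.
    have : g x <= A^-1 * (x * g x).
      by rewrite mulrA ler_peMl ?g_ge0// mulrC ler_pdivlMr// mul1r ltW.
    have : 0 <= low x by exact: lower_step_ge0.
    lra.
  (* [tail_ge] costs one grid step, so the lower sum for L is compared with the upper one for
     [mu]. *)
  have Llow : L low <= \int[mu]_(x in D) up x.
    rewrite up_e low_L; apply: ler_sum => i _.
    by apply: ler_wpM2l; [exact: step_incr_ge0|exact: tail_ge].
  have Iup : \int[mu]_(x in D) up x <= \int[mu]_(x in D) low x + w.
    apply: (@le_trans _ _ (\int[mu]_(x in D) (low x + w))).
      apply: le_Rintegral => //.
        by apply: eq_integrable (integrableD _ low_i cst_i).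
      by move=> x _; exact: upper_step_le.
    by rewrite RintegralD// lerD2l.
  have -> : 2 * (Num.max K 0 * A) / N.+1%:R = 2 * w by rewrite -mulrA.
  move: Lg Llow Iup; rewrite -/low -/up.
  move: (L low) (L g) (\int[mu]_(x in D) up x) (\int[mu]_(x in D) low x) => *.
  by lra.
Qed.

(** Monotone convergence over the intervals ]0, n + 1] yields integrability and one inequality; the
    grid estimate then yields the other. *)
Lemma representation : mu.-integrable D (EFin \o g) /\ \int[mu]_(x in D) g x = L g.
Proof.
have g_pos x : D x -> (0 <= (g x)%:E)%E.
  by move=> /pos_itvP x0; rewrite lee_fin g_ge0// ltW.
have gE_meas : measurable_fun D (EFin \o g) by exact/measurable_EFinP.
pose I (n : nat) : set (measurableTypeR R) := `]0, n.+1%:R]%classic.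
have I_D n : I n `<=` D.
  by move=> x; rewrite /I /D /pos_itv /= !in_itv /= => /andP[->].
have trunc n : (\int[mu]_(x in I n) (g x)%:E <= (L g)%:E)%E.
  have [C C0 H] := grid_bounds (ltr0Sn R n).
  have bound N : (\int[mu]_(x in I n) (g x)%:E <= (L g + C / N.+1%:R)%:E)%E.
    have w0 : 0 <= C / N.+1%:R by rewrite divr_ge0.
    have [low [low_i low0 _ glow] [Ilow _]] := H N.
    have [cst_i cst_e] := integral_cst_le w0.
    have sum_i : mu.-integrable D (EFin \o (fun x => low x + C / N.+1%:R)).
      by apply: eq_integrable (integrableD _ low_i cst_i).
    have sum_m : measurable_fun D (EFin \o (fun x => low x + C / N.+1%:R)).
      by case/integrableP: sum_i.
    have mI : measurable (I n) by exact: measurable_itvR.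
    apply: (@le_trans _ _ (\int[mu]_(x in I n) (low x + C / N.+1%:R)%:E)%E).
      apply: ge0_le_integral => //.
      - by move=> x /I_D; exact: g_pos.
      - exact: measurable_funS gE_meas.
      - exact: measurable_funS sum_m.
      - move=> x Ix; rewrite lee_fin glow//.
        by move: Ix; rewrite /I /= in_itv /= => /andP[/ltW -> ->].
    apply: (@le_trans _ _ (\int[mu]_(x in D) (low x + C / N.+1%:R)%:E)%E).
      apply: ge0_subset_integral => //.
      by move=> x _; rewrite lee_fin addr_ge0.
    rewrite -[leLHS]fineK ?integrable_fin_num// lee_fin.
    have := RintegralD (@measurable_pos_itv R) low_i cst_i.
    by rewrite {1}/Rintegral => ->; exact: lerD.
  have fin : (\int[mu]_(x in I n) (g x)%:E)%E \is a fin_num.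
    rewrite ge0_fin_numE; first exact: le_lt_trans (bound 0%N) (ltry _).
    by apply: integral_ge0 => x /I_D; exact: g_pos.
  rewrite -[leLHS]fineK// lee_fin; apply: (@ler_add_invn _ _ _ C) => N.
  by rewrite -lee_fin fineK.
have int_le : (\int[mu]_(x in D) (g x)%:E <= (L g)%:E)%E.
  have DE : D = \bigcup_n I n.
    apply/seteqP; split=> [x /pos_itvP x0|x [n _] /I_D//].
    exists (Num.truncn (x : R)) => //=.
    by rewrite /I /= in_itv /= x0 ltW// truncnS_gt.
  rewrite DE; have cv : (\int[mu]_(x in I n) (g x)%:E)%E @[n --> \oo] -->
      (\int[mu]_(x in \bigcup_n I n) (g x)%:E)%E.
    apply: ge0_nondecreasing_set_cvg_integral.
    - move=> i j ij; apply/subsetPset => x; rewrite /I /= !in_itv /=.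
      by move=> /andP[-> /le_trans]; apply; rewrite ler_nat.
    - by move=> i; exact: measurable_itvR.
    - by move=> i; exact: measurable_funS gE_meas.
    - by move=> i x /I_D; exact: g_pos.
  rewrite -(cvg_lim _ cv)//; apply: lime_le; first by apply/cvg_ex; eexists; exact: cv.
  by apply: nearW => n; exact: trunc.
have gi : mu.-integrable D (EFin \o g).
  apply/integrableP; split; first exact/measurable_EFinP.
  apply: le_lt_trans (ltry (L g)); apply: le_trans int_le.
  rewrite le_eqVlt; apply/orP; left; apply/eqP; apply: eq_integral => x.
  by move=> /set_mem/pos_itvP x0 /=; rewrite ger0_norm// g_ge0// ltW.
split=> //; apply/eqP; rewrite eq_le; apply/andP; split.
  rewrite -lee_fin; apply: le_trans int_le.
  by rewrite /Rintegral fineK// integrable_fin_num.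
(* The cutoff n + 1 goes to infinity only after the mesh has gone to 0, because C depends on the
   cutoff. *)
apply: (@ler_add_invn _ _ _ (L (fun x => x * g x))) => n.
have [C C0 H] := grid_bounds (ltr0Sn R n).
apply: (@ler_add_invn _ _ _ (2 * C)) => N.
have [low [low_i low0 lowg _] [_ Lg]] := H N.
have : \int[mu]_(x in D) low x <= \int[mu]_(x in D) g x.
  by apply: le_Rintegral => // x /pos_itvP/ltW; exact: lowg.
move=> low_g; by apply: (le_trans Lg); rewrite addrAC !lerD2r.
Qed.

End monotone_test_function.
End representation.

(** * The measure of a positive functional *)

Section functional_measure.
Variables (R : realType) (L : (R -> R) -> R).
Hypotheses (L_pos : pos_functional L) (L1 : L (fun=> 1) = 1).
Variable C : R.
(** This excludes an atom at 0. *)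
Hypothesis L_small : forall d, 0 < d -> L (fun x => (x <= d)%R%:R) <= C * d.

Let G y := L (fun x => (x <= y)%R%:R).
Let ind t (x : R) : R := (t < x)%R%:R.

Let G_bd y : polybd (fun x => (x <= y)%R%:R : R).
Proof. exact: (polybd_indic (fun x => x <= y)). Qed.
Let ind_bd y : polybd (ind y).
Proof. exact: (polybd_indic (fun x => y < x)). Qed.

Let G_ge0 y : 0 <= G y.
Proof. by apply: L_pos.2. Qed.

Let G_nd x y : x <= y -> G x <= G y.
Proof.
move=> xy; apply: (le_functional L_pos) => // z _.
by have [zx|//] := leP z x; rewrite (le_trans zx xy).
Qed.

Let G_neg y : y < 0 -> G y = 0.
Proof.
move=> y0; apply/eqP; rewrite eq_le G_ge0 andbT -(functional0 L_pos).
apply: (le_functional L_pos) => //; first exact: polybd0.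
by move=> x x0; rewrite (_ : (x <= y) = false)// leNgt (lt_le_trans y0 x0).
Qed.

Let L_ind y : L (ind y) = 1 - G y.
Proof.
apply/eqP; rewrite eq_sym subr_eq eq_sym -(functionalD L_pos)// -L1; apply/eqP.
by congr L; apply/funext => x; rewrite /ind; case: leP => _; rewrite ?addr0 ?add0r.
Qed.

(** The right limit of the nondecreasing [G], taken because a distribution function must be
    right-continuous. *)
Let F t := inf [set G y | y in [set y | t < y]].

Let F_set t : [set G y | y in [set y | t < y]] !=set0.
Proof. by exists (G (t + 1)), (t + 1) => //=; rewrite ltrDl. Qed.

Let F_lb t : has_lbound [set G y | y in [set y | t < y]].
Proof. by exists 0 => _ [y _ <-]. Qed.

Let F_le t y : t < y -> F t <= G y.
Proof. by move=> ty; apply: ge_inf => //; exists y. Qed.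

Let F_ge t : G t <= F t.
Proof. by apply: lb_le_inf => // _ [y /= ty <-]; exact/G_nd/ltW. Qed.

Let F_nd : {homo F : x y / x <= y}.
Proof.
move=> x y xy; apply: lb_le_inf => // _ [z /= yz <-].
by apply: F_le; exact: le_lt_trans yz.
Qed.

Let F_rc : right_continuous F.
Proof.
move=> a; apply/cvgrPdist_le => e e0.
have [_ [y /= ay <-] yF] := inf_adherent e0 (conj (F_set a) (F_lb a)).
near=> x; have ax : a <= x by apply: ltW; near: x; exact: nbhs_right_gt.
have xy : x < y by near: x; exact: nbhs_right_lt.
rewrite distrC ger0_norm ?subr_ge0 ?F_nd//.
by have := F_le xy; move: yF; rewrite -/(F a); lra.
Unshelve. all: by end_near. Qed.

Let F_Ny : F @ -oo --> (0 : R).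
Proof.
apply: cvg_near_cst; near=> t; have t0 : t < 0 by near: t; exact: nbhs_ninfty_lt.
apply/eqP; rewrite eq_le (le_trans (G_ge0 t) (F_ge t)) andbT.
have th : t < t / 2 by lra.
by rewrite (le_trans (F_le th))// G_neg//; lra.
Unshelve. all: by end_near. Qed.

Let id_bd : polybd (fun x : R => x).
Proof.
have := polybd_horner ('X : {poly R}); congr polybd.
by apply/funext => x; rewrite hornerX.
Qed.

Let F_le1 t : F t <= 1.
Proof.
apply: (le_trans (F_le (_ : t < t + 1))); first by rewrite ltrDl.
rewrite -subr_ge0 -L_ind; exact: L_pos.2.
Qed.

(** Markov's inequality: the indicator of x > t is at most x / t on the half-line. *)
Let F_y : F @ +oo --> (1 : R).
Proof.
apply/cvgrPdist_le => e e0; pose K := L (fun x => x).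
near=> t; have t0 : 0 < t by near: t; exact: nbhs_pinfty_gt.
have tK : K / e < t by near: t; apply: nbhs_pinfty_gt; exact: num_real.
rewrite ger0_norm ?subr_ge0//.
apply: (@le_trans _ _ (1 - G t)); first by rewrite lerD2l lerN2.
rewrite -L_ind; apply: (@le_trans _ _ (t^-1 * K)).
  rewrite -(functionalZ L_pos)//; apply: (le_functional L_pos) => //.
    exact: polybdZ.
  move=> x x0; rewrite /ind; have [tx|xt] := ltP t x.
    by rewrite mulrC ler_pdivlMr// mul1r ltW.
  by rewrite mulr_ge0// invr_ge0 ltW.
by rewrite mulrC ler_pdivrMr// mulrC -ler_pdivrMr// ltW.
Unshelve. all: by end_near. Qed.

(** For the Lebesgue-Stieltjes measure of [F], the tail inequalities express G(x) <= F(x) <= G(y)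
    for x < y. *)
Lemma functional_measure :
  exists mu : {measure set (measurableTypeR R) -> \bar R},
    [/\ mu setT = 1%E, mu `]-oo, 0]%classic = 0%E,
      forall x y, 0 <= x -> x < y -> L (ind y) <= fine (mu `]x, +oo[%classic) &
      forall x, 0 <= x -> fine (mu `]x, +oo[%classic) <= L (ind x)].
Proof.
pose Fc : cumulativeBounded (0 : R) (1 : R) := HB.pack F
  (isCumulative.Build R _ R F F_nd F_rc)
  (isCumulativeBounded.Build R 0 1 F F_Ny F_y).
pose P : probability (measurableTypeR R) R := lebesgue_stieltjes_measure Fc.
have PF r : P `]-oo, r]%classic = (F r)%:E by exact: (cdf_lebesgue_stieltjes_id Fc r).
have tail t : fine (P `]t, +oo[%classic) = 1 - F t.
  rewrite -setCitvl probability_setC; last exact: measurable_itvR.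
  by rewrite PF.
exists P; split.
- exact: probability_setT.
- transitivity (F 0)%:E; [exact: (PF 0)|congr EFin; apply/eqP].
  rewrite eq_le (le_trans (G_ge0 0) (F_ge 0)) andbT.
  apply: (@ler_add_invn _ _ _ C) => n; rewrite add0r.
  have n0 : 0 < n.+1%:R^-1 :> R by rewrite invr_gt0.
  exact: le_trans (F_le n0) (L_small n0).
- move=> x y x0 xy; apply: (@le_trans _ _ (1 - F x)).
    by rewrite L_ind lerD2l lerN2 F_le.
  by rewrite -tail.
- move=> x x0; apply: (@le_trans _ _ (1 - F x)); first by rewrite -tail.
  by rewrite L_ind lerD2l lerN2 F_ge.
Qed.

End functional_measure.

(** * Finite strings *)

Section existence.
Variables (R : realType) (s m l : nat -> R).
Hypothesis string_ml : moment_string s m l.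
Variables (M Lb c : R).
Hypothesis sum_m : forall n, \sum_(i < n) m i <= M.
Hypothesis sum_l : forall n, \sum_(i < n) l i <= Lb.
Hypothesis c_ge : Lb <= c.

Let m_gt0 i : 0 < m i. Proof. by case: string_ml. Qed.
Let l_gt0 i : 0 < l i. Proof. by case: string_ml. Qed.
Let Y := stringY m l.
Let Z := stringZ m l.

(* If tau has these moments then rho = x^2 tau has the moments s, has no atom at
   0 and satisfies int (1/x) drho = c. *)
Let ext (k : nat) : R :=
  match k with 0 => M * c ^+ 2 | 1 => c | k'.+2 => s k' end.

Let mom_extX p : mom (ext \o S) ('X * p) = mom s p.
Proof. by rewrite momXM. Qed.

Lemma mom_sqr_sumY n (a : nat -> R) :
  mom s ((\sum_(i < n) a i *: Y i) ^+ 2) = \sum_(i < n) a i ^+ 2 / m i.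
Proof.
rewrite expr2 mulr_suml linear_sum; apply: eq_bigr => i _ /=.
rewrite mulr_sumr linear_sum (bigD1 i)//= big1 ?addr0 => [|j ji].
  rewrite -scalerAl -scalerAr !linearZ /= (mom_stringY_mul string_ml) eqxx.
  by rewrite mulrA expr2 mul1r.
rewrite -scalerAl -scalerAr !linearZ /= (mom_stringY_mul string_ml).
by rewrite (_ : (i == j :> nat) = false) ?mul0r ?mulr0// eq_sym; apply/negbTE.
Qed.

Lemma mom_X_sqr_sumZ n (a : nat -> R) :
  mom s ('X * (\sum_(i < n) a i *: Z i) ^+ 2) = \sum_(i < n) a i ^+ 2 / l i.
Proof.
rewrite expr2 mulr_suml mulr_sumr linear_sum; apply: eq_bigr => i _ /=.
rewrite !mulr_sumr linear_sum (bigD1 i)//= big1 ?addr0 => [|j ji].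
  rewrite -scalerAl -!scalerAr !linearZ /= (mom_XZ_mul string_ml) eqxx.
  by rewrite mulrA expr2 mul1r.
rewrite -scalerAl -!scalerAr !linearZ /= (mom_XZ_mul string_ml).
by rewrite (_ : (i == j :> nat) = false) ?mul0r ?mulr0// eq_sym; apply/negbTE.
Qed.

Let split_sqr (a : R) (q : {poly R}) :
  (a%:P + 'X * q) ^+ 2 = (a ^+ 2)%:P + 'X * (a *: q + a *: q + 'X * q ^+ 2).
Proof. by rewrite -mul_polyC polyC_exp; ring. Qed.

(** Since Y_i is 1 - X times the sum of the l_j Z_j with j < i, the value is c minus a partial
    length. *)
Let mom_extY i : 0 <= mom (ext \o S) (Y i) <= c.
Proof.
have -> : mom (ext \o S) (Y i) = c - \sum_(j < i) l j.
  rewrite /Y stringY_sumZ momB mom1 mom_extX mom_sum.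
  congr (_ - _); apply: eq_bigr => j _.
  by rewrite momZ (mom_stringZ string_ml) mulr1.
rewrite subr_ge0 (le_trans (sum_l i) c_ge)/= lerBlDr lerDl.
by apply: sumr_ge0 => j _; exact: ltW.
Qed.

(** For r = a + X q and q the sum of the a_i Y_i, the value is a^2 M c^2 plus the terms 2 a a_i e_i
    + a_i^2 / m_i with 0 <= e_i <= c. Completing squares costs at most a^2 c^2 m_i each, and the
    masses sum to at most M. *)
Lemma mom_ext_sqr_ge0 r : 0 <= mom ext (r ^+ 2).
Proof.
have [q ->] := poly_split0 r; move: r.[0] => a.
have [a_ qE] := triangular_expansion (size_stringY m_gt0 l_gt0) (leqnn (size q)).
have mq2 : mom s (q ^+ 2) = \sum_(i < size q) a_ i ^+ 2 / m i.
  by rewrite {1}qE mom_sqr_sumY.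
have mq : mom (ext \o S) q = \sum_(i < size q) a_ i * mom (ext \o S) (Y i).
  by rewrite {1}qE mom_sum; apply: eq_bigr => i _; rewrite momZ.
rewrite split_sqr momD momC momXM !momD momZ mom_extX mq2 mq.
have -> : ext 0 = M * c ^+ 2 by [].
have term i : 0 <= (a * c) ^+ 2 * m i +
    (2 * a * (a_ i * mom (ext \o S) (Y i)) + a_ i ^+ 2 / m i).
  have /andP[] := mom_extY i; move: (mom _ (Y i)) => e e0 ec.
  have -> : (a * c) ^+ 2 * m i + (2 * a * (a_ i * e) + a_ i ^+ 2 / m i) =
      m i * (a ^+ 2 * (c ^+ 2 - e ^+ 2)) + m i * (a * e + a_ i / m i) ^+ 2.
    by field; rewrite gt_eqF.
  have m0 := ltW (m_gt0 i).
  rewrite addr_ge0// mulr_ge0 ?sqr_ge0// mulr_ge0 ?sqr_ge0//.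
  by rewrite subr_ge0 ler_pXn2r// nnegrE (le_trans e0 ec).
have : 0 <= \sum_(i < size q) ((a * c) ^+ 2 * m i +
    (2 * a * (a_ i * mom (ext \o S) (Y i)) + a_ i ^+ 2 / m i)).
  by apply: sumr_ge0 => i _; exact: term.
rewrite 2!big_split /= -!mulr_sumr.
have : 0 <= (a * c) ^+ 2 * (M - \sum_(i < size q) m i).
  by rewrite mulr_ge0 ?sqr_ge0// subr_ge0.
lra.
Qed.

(** Expanding q in the Z_i gives a^2 c plus the terms 2 a a_i + a_i^2 / l_i; completing squares
    costs a^2 l_i each, and the lengths sum to at most c. *)
Lemma mom_ext_X_sqr_ge0 r : 0 <= mom ext ('X * r ^+ 2).
Proof.
have [q ->] := poly_split0 r; move: r.[0] => a.
have [a_ qE] := triangular_expansion (size_stringZ m_gt0 l_gt0) (leqnn (size q)).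
have mq2 : mom s ('X * q ^+ 2) = \sum_(i < size q) a_ i ^+ 2 / l i.
  by rewrite {1}qE mom_X_sqr_sumZ.
have mq : mom s q = \sum_(i < size q) a_ i.
  rewrite {1}qE mom_sum; apply: eq_bigr => i _.
  by rewrite momZ (mom_stringZ string_ml) mulr1.
rewrite momXM split_sqr momD momC mom_extX !momD momZ mq2 mq /=.
have term i : 0 <= a ^+ 2 * l i + (2 * a * a_ i + a_ i ^+ 2 / l i).
  have -> : a ^+ 2 * l i + (2 * a * a_ i + a_ i ^+ 2 / l i) =
      l i * (a + a_ i / l i) ^+ 2 by field; rewrite gt_eqF.
  by rewrite mulr_ge0 ?sqr_ge0// ltW.
have : 0 <= \sum_(i < size q)
    (a ^+ 2 * l i + (2 * a * a_ i + a_ i ^+ 2 / l i)).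
  by apply: sumr_ge0 => i _; exact: term.
rewrite 2!big_split /= -!mulr_sumr.
have : 0 <= a ^+ 2 * (c - \sum_(i < size q) l i).
  by rewrite mulr_ge0 ?sqr_ge0// subr_ge0 (le_trans (sum_l _)).
lra.
Qed.

(* A bounded substitute for -1/x, shifted so as to vanish at 0. *)
Definition cut_inv (d x : R) : R := d^-1 - (Num.max x d)^-1.

Lemma cut_inv_nd d x y : 0 < d -> x <= y -> cut_inv d x <= cut_inv d y.
Proof.
move=> d0 xy; rewrite lerD2l lerN2 lef_pV2 ?posrE ?lt_max ?d0 ?orbT//.
by rewrite ge_max !le_max xy lexx orbT.
Qed.

(** L0 extends the functional of [ext], and L f = L0 (x^2 f) has moments s. The integral of
    [cut_inv d] is 1 / d - L0 (x^2 / max(x, d)), where the argument of L0 lies between x - d and x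
    while L0 x = c and L0 1 = M c^2. *)
Lemma exists_solution : exists2 rho : {measure set (measurableTypeR R) -> \bar R},
  stieltjes_solution s rho &
  forall d, 0 < d -> d^-1 - c <=
    \int[rho]_(x in pos_itv R) cut_inv d x <= d^-1 - c + d * (M * c ^+ 2).
Proof.
have s0 : s 0%N = 1 by case: string_ml => _ _ _ ->.
have [L0 L0_pos L0p] := riesz_extension (mom_is_linear ext)
  (fun p => functional_half_line_ge0 (mom_is_linear ext) mom_ext_sqr_ge0 mom_ext_X_sqr_ge0).
have pow_bd k : polybd (fun x : R => x ^+ k).
  have := polybd_horner ('X^k : {poly R}); congr polybd.
  by apply/funext => x; rewrite hornerXn.
have L0k k : L0 (fun x => x ^+ k) = ext k.
  by rewrite -(momXn ext) -L0p; congr L0; apply/funext => x; rewrite hornerXn.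
pose L f := L0 (fun x => x ^+ 2 * f x).
have L_pos : pos_functional L.
  split=> [k f g bf bg|f bf f0]; last first.
    apply: L0_pos.2; first exact: polybd_mul.
    by move=> x x0; rewrite mulr_ge0 ?sqr_ge0 ?f0.
  rewrite /L -L0_pos.1; [|exact: polybd_mul..].
  by congr L0; apply/funext => x; ring.
have L1 : L (fun=> 1) = 1.
  by rewrite -[RHS]s0 -[s 0%N]/(ext 2) -L0k; congr L0; apply/funext => x; rewrite mulr1.
(* On [0, d] one has x^2 <= d x, and L0 x = c. *)
have L_small d : 0 < d -> L (fun x => (x <= d)%R%:R) <= c * d.
  move=> d0; have -> : c * d = L0 (fun x => d * x ^+ 1).
    by rewrite (functionalZ L0_pos)// L0k mulrC.
  apply: (le_functional L0_pos).
  - apply: polybd_mul => //; exact: (polybd_indic (fun x => x <= d)).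
  - exact: polybdZ.
  - move=> x x0; have [xd|dx] := leP x d; last by rewrite mulr0 mulr_ge0// ltW.
    by rewrite mulr1 expr2 expr1 ler_wpM2r.
have [mu [muT mu0 tail_ge tail_le]] := functional_measure L_pos L1 L_small.
have rep := @representation R L mu L_pos L1 muT tail_ge tail_le.
exists mu.
  have D1 : mu (pos_itv R) = 1%E.
    rewrite -muT; have -> : [set: measurableTypeR R] = pos_itv R `|` `]-oo, 0]%classic.
      apply/esym/seteqP; split=> // x _; rewrite /pos_itv /= !in_itv /= andbT.
      by case: (ltP 0 (x : R)); [left|right].
    by rewrite measureU0//; exact: measurable_itvR.
  have mk (k : nat) : measurable_fun (pos_itv R) (fun x => x ^+ k : R).
    by apply: measurable_funX; exact: measurable_id.
  split=> // k.
  have [ki ke] : mu.-integrable (pos_itv R) (fun x => (x ^+ k)%:E) /\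
      (\int[mu]_(x in pos_itv R) (x ^+ k)%:E = (s k)%:E)%E.
    (* Test functions must vanish at 0, so the moment of order 0 is read off from the total mass. *)
    case: k => [|k].
      have e1 : (\int[mu]_(x in pos_itv R) (x ^+ 0)%:E = 1)%E.
        under eq_integral do rewrite expr0.
        by rewrite integral_cst// mul1e.
      split; last by rewrite e1 s0.
      apply/integrableP; split; first exact/measurable_EFinP.
      under eq_integral => x _ do rewrite /= expr0 normr1.
      by rewrite integral_cst// mul1e D1 ltry.
    have [||||A|ki ke] := rep (fun x => x ^+ k.+1).
    - exact: mk.
    - by rewrite expr0n.
    - exact: pow_bd.
    - by move=> x y x0 xy; rewrite ler_pXn2r// nnegrE (le_trans x0 xy).
    - elim: k => [|k [K gK]].
        by exists 1 => x y _ _ _; rewrite mul1r !expr1.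
      exists (A * K + A ^+ k.+1) => x y x0 xy yA.
      have y0 := le_trans x0 xy; have A0 := le_trans y0 yA.
      have -> : y ^+ k.+2 - x ^+ k.+2 =
          y * (y ^+ k.+1 - x ^+ k.+1) + x ^+ k.+1 * (y - x).
        by rewrite !(exprS _ k.+1); ring.
      rewrite mulrDl lerD//; last first.
        by rewrite ler_wpM2r ?subr_ge0// ler_pXn2r// ?nnegrE// (le_trans xy).
      rewrite -mulrA ler_pM ?gK//.
      by rewrite subr_ge0 ler_pXn2r// nnegrE.
    - split=> //; rewrite -[LHS]fineK ?integrable_fin_num//.
      congr EFin; rewrite -/(Rintegral _ _ _) ke -[RHS]/(ext k.+3) -L0k.
      by congr L0; apply/funext => x; rewrite -exprD.
  have mT : measurable_fun [set: measurableTypeR R] (fun x => (x ^+ k)%:E).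
    by apply/measurable_EFinP; apply: measurable_funX; exact: measurable_id.
  have DE : [set: measurableTypeR R] `\` `]-oo, 0]%classic = pos_itv R.
    by rewrite setTD setCitvl.
  have ki' : mu.-integrable setT (fun x => (x ^+ k)%:E).
    by apply/(negligible_integrable (measurable_itvR `]-oo, 0]) measurableT mT mu0);
      rewrite DE.
  split=> //.
  by rewrite (negligible_integral (measurable_itvR `]-oo, 0]) measurableT ki' mu0) DE.
move=> d d0.
have mx0 x : 0 < Num.max x d by rewrite lt_max d0 orbT.
have inv_le x : (Num.max x d)^-1 <= d^-1 by rewrite lef_pV2 ?posrE// le_max lexx orbT.
have cut_bd : polybd (cut_inv d).
  exists d^-1%:P => x x0; rewrite hornerC ger0_norm ?subr_ge0//.
  by rewrite lerBlDr lerDl invr_ge0 ltW.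
have inv_bd : polybd (fun x => (Num.max x d)^-1).
  exists d^-1%:P => x x0; rewrite hornerC ger0_norm//.
  by rewrite invr_ge0 ltW.
have [|||||_ ->] := rep (cut_inv d).
- apply: nondecreasing_measurable; first exact: measurable_itvR.
  by move=> x y; exact: cut_inv_nd.
- by rewrite /cut_inv (max_idPr (ltW d0)) subrr.
- by [].
- by move=> x y _; exact: cut_inv_nd.
- move=> A; exists (d^-1 ^+ 2) => x y x0 xy yA.
  have -> : cut_inv d y - cut_inv d x =
      (Num.max x d)^-1 * (Num.max y d)^-1 * (Num.max y d - Num.max x d).
    by rewrite /cut_inv; field; rewrite !gt_eqF.
  apply: ler_pM.
  + by rewrite mulr_ge0// invr_ge0 ltW.
  + by rewrite subr_ge0 ge_max !le_max xy lexx orbT.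
  + by rewrite expr2 ler_pM// invr_ge0 ltW.
  + by have [xd|dx] := leP x d; have [yd|dy] := leP y d; lra.
pose h x := x ^+ 2 * (Num.max x d)^-1.
have h_bd : polybd h by exact: polybd_mul.
have -> : L (cut_inv d) = d^-1 - L0 h.
  have x2 : L0 (fun x => d^-1 * x ^+ 2) = d^-1.
    by rewrite (functionalZ L0_pos)// L0k -[RHS]mulr1 -s0.
  rewrite -[in RHS]x2 addrC -mulN1r -L0_pos.1//; last exact: polybdZ.
  by congr L0; apply/funext => x; rewrite /h /cut_inv; ring.
have h_le : L0 h <= c.
  rewrite -[leRHS]/(ext 1) -L0k; apply: (le_functional L0_pos) => // x x0.
  rewrite /h expr2 expr1 -mulrA ler_piMr// ler_pdivrMr// mul1r.
  by rewrite le_max lexx.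
have h_ge : c - d * (M * c ^+ 2) <= L0 h.
  rewrite -[X in X - _]/(ext 1) -[M * _]/(ext 0) -!L0k addrC -mulNr -L0_pos.1//.
  apply: (le_functional L0_pos) => //; first exact: polybd_lin.
  move=> x x0; rewrite expr0 mulr1 expr1 /h.
  have [xd|dx] := leP x d.
    rewrite (@le_trans _ _ 0)//; first by rewrite addrC subr_le0.
    by rewrite mulr_ge0 ?sqr_ge0// invr_ge0 ltW.
  by rewrite expr2 mulfK ?gt_eqF ?(lt_trans d0)// gerDr oppr_le0 ltW.
lra.
Qed.

End existence.

(** For c = Lb and c = Lb + 1 the main parts of the integrals of [cut_inv d] differ by 1, while the
    error d M (Lb + 1)^2 vanishes with d. *)
Lemma finite_string_indeterminate (R : realType) (s m l : nat -> R) (M Lb : R) :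
  moment_string s m l -> (forall n, \sum_(i < n) m i <= M) ->
  (forall n, \sum_(i < n) l i <= Lb) -> stieltjes_indeterminate s.
Proof.
move=> ml sm sl det.
have M0 : 0 <= M by have := sm 0%N; rewrite big_ord0.
have [rho1 sol1 b1] := exists_solution ml sm sl (lexx Lb).
have [|rho2 sol2 b2] := exists_solution ml sm sl (_ : Lb <= Lb + 1).
  by rewrite lerDl.
have e12 d : \int[rho1]_(x in pos_itv R) cut_inv d x =
    \int[rho2]_(x in pos_itv R) cut_inv d x.
  by congr fine; apply: eq_measure_integral => A mA _; exact: det.
have : (1 : R) <= 0.
  apply: (@ler_add_invn _ _ _ (M * (Lb + 1) ^+ 2)) => n.
  have n0 : 0 < n.+1%:R^-1 :> R by rewrite invr_gt0.
  have /andP[H1 _] := b1 _ n0; have /andP[_ H2] := b2 _ n0.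
  have : forall D I K : R, D - Lb <= I -> I <= D - (Lb + 1) + K -> 1 <= K.
    by move=> *; lra.
  by rewrite add0r mulrC; apply; first exact: H1; rewrite e12; exact: H2.
by rewrite ler10.
Qed.

(** For the kernel r at -1 both r(-1) and the functional at r^2 equal the local [S], so d S^2 <= S
    bounds [S] by 1 / d. It dominates the sum of the masses because Y_i(-1) >= 1; the lengths follow
    alike from X r^2. *)
Lemma indeterminate_finite_string (R : realType) (s m l : nat -> R) :
  moment_string s m l -> stieltjes_indeterminate s ->
  exists M, forall n, \sum_(i < n) m i <= M /\ \sum_(i < n) l i <= M.
Proof.
move=> ml /indeterminate_bound[d d0 bound].
have [m_gt0 l_gt0 m0 _] := ml.
have le_inv S : 0 <= S -> d * `|S ^+ 2| <= S -> S <= d^-1.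
  move=> S0; rewrite ger0_norm ?sqr_ge0//.
  have [->|Sn0] := eqVneq S 0; first by move=> _; rewrite invr_ge0 ltW.
  rewrite expr2 mulrA -[leRHS]mul1r ler_pM2r; last by rewrite lt_neqAle eq_sym Sn0.
  by rewrite -ler_pdivlMl// mulr1.
have YZ := stringYZ_atN1 m_gt0 l_gt0 m0.
exists d^-1 => n; split.
- pose S := \sum_(i < n) m i * (stringY m l i).[-1] ^+ 2.
  have mS : \sum_(i < n) m i <= S.
    apply: ler_sum => i _; rewrite ler_peMr ?(ltW (m_gt0 i))//.
    by rewrite exprn_ege1//; case: (YZ i).
  apply: (le_trans mS); apply: le_inv.
    by apply: sumr_ge0 => i _; rewrite mulr_ge0 ?sqr_ge0// ltW.
  pose r := \sum_(i < n) (m i * (stringY m l i).[-1]) *: stringY m l i.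
  have rS : r.[-1] = S.
    rewrite horner_sum; apply: eq_bigr => i _.
    by rewrite hornerZ -mulrA expr2.
  have := bound (r ^+ 2); rewrite horner_exp rS.
  rewrite (mom_sqr_sumY ml n (fun i => m i * (stringY m l i).[-1])).
  rewrite (eq_bigr (fun i : 'I_n => m i * (stringY m l i).[-1] ^+ 2)); last first.
    by move=> i _; field; rewrite gt_eqF.
  by apply => x _; rewrite horner_exp sqr_ge0.
- pose S := \sum_(i < n) l i * (stringZ m l i).[-1] ^+ 2.
  have lS : \sum_(i < n) l i <= S.
    apply: ler_sum => i _; rewrite ler_peMr ?(ltW (l_gt0 i))//.
    by rewrite exprn_ege1//; case: (YZ i).
  apply: (le_trans lS); apply: le_inv.
    by apply: sumr_ge0 => i _; rewrite mulr_ge0 ?sqr_ge0// ltW.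
  pose r := \sum_(i < n) (l i * (stringZ m l i).[-1]) *: stringZ m l i.
  have rS : r.[-1] = S.
    rewrite horner_sum; apply: eq_bigr => i _.
    by rewrite hornerZ -mulrA expr2.
  have := bound ('X * r ^+ 2); rewrite hornerM hornerX horner_exp rS mulN1r normrN.
  rewrite (mom_X_sqr_sumZ ml n (fun i => l i * (stringZ m l i).[-1])).
  rewrite (eq_bigr (fun i : 'I_n => l i * (stringZ m l i).[-1] ^+ 2)); last first.
    by move=> i _; field; rewrite gt_eqF.
  by apply => x x0; rewrite hornerM hornerX horner_exp mulr_ge0 ?sqr_ge0 ?ltW.
Qed.

(** * Partial sums and the equivalence *)

Lemma series_ltyP (R : realType) (u : nat -> R) : (forall i, 0 < u i) ->
  (exists M, forall n, \sum_(i < n) u i <= M) <->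
  (\sum_(0 <= k <oo) (u k)%:E < +oo)%E.
Proof.
move=> u0; have uE n : (\sum_(0 <= k < n) (u k)%:E = (\sum_(i < n) u i)%:E)%E.
  by rewrite sumEFin big_mkord.
split=> [[M sM]|].
  apply: (@le_lt_trans _ _ M%:E); last exact: ltry.
  apply: lime_le; first by apply: is_cvg_nneseries => i _ _; rewrite lee_fin ltW.
  by apply: nearW => n; rewrite uE lee_fin.
move=> fin; exists (fine (\sum_(0 <= k <oo) (u k)%:E)%E) => n.
rewrite -lee_fin fineK -?uE.
  by apply: nneseries_lim_ge => i _; rewrite lee_fin ltW.
rewrite ge0_fin_numE//; apply: nneseries_ge0 => i _ _.
by rewrite lee_fin ltW.
Qed.

Lemma cvg_partial_sums (R : realType) (u v : nat -> R) : (forall i, 0 < u i) ->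
  (forall n, v n = \sum_(i < n) u i) ->
  ((v n)%:E @[n --> \oo] --> (\sum_(0 <= k <oo) (u k)%:E)%E).
Proof.
move=> u0 vE; have -> : (fun n => (v n)%:E) = (fun n => \sum_(0 <= k < n) (u k)%:E)%E.
  by apply/funext => n; rewrite sumEFin big_mkord vE.
by apply: is_cvg_nneseries => i _ _; rewrite lee_fin ltW.
Qed.

Theorem proposition14 (R : realType) (s : nat -> R) (s0 : s 0%N = 1)
    (hankel_pd : forall N : nat, posdefmx (hankel_mx s N))
    (hankel_shift_pd :
       forall N : nat, posdefmx (hankel_mx (fun k => s k.+1) N))
    (m l : nat -> R) (string_ml : moment_string s m l) :
  stieltjes_indeterminate s <->
  (((mass_form s T)%:E @[T --> \oo] --> string_mass m) /\
   (string_mass m < +oo)%E) /\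
  (((- length_quotient s K)%:E @[K --> \oo] --> string_length l) /\
   (string_length l < +oo)%E).
Proof.
have [m_gt0 l_gt0 _ _] := string_ml.
have mass_cvg := cvg_partial_sums m_gt0 (fun n => mass_formE n string_ml).
have len_cvg : (- length_quotient s K)%:E @[K --> \oo] --> string_length l.
  apply: cvg_partial_sums => // n.
  by rewrite (length_quotientE n string_ml) opprK.
(* Both limits hold for every string, so only the finiteness of the two sums is at stake. *)
split=> [indet|[[_ /(series_ltyP m_gt0)[M sM]] [_ /(series_ltyP l_gt0)[Lb sL]]]].
  have [M ML] := indeterminate_finite_string string_ml indet.
  split; split=> //; [apply/(series_ltyP m_gt0)|apply/(series_ltyP l_gt0)];
    by exists M => n; case: (ML n).
exact: finite_string_indeterminate string_ml sM sL.
Qed.
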